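(* Consider a single class switched network (as described in the context) with an arbitrary set of schedules $\mathcal S$ and an arbitrary mean routing matrix $\mathbf P$ (of an open network), operated under the weighted MaxWeight policy, which, given the queue length vector $\mathbf Q$, uses a schedule solving $$\text{maximize}\quad \sum_{j\in\mathcal J}Q_j\frac{\sigma_j}{\rho_j}\quad\text{over }\boldsymbol\sigma\in\mathcal S .$$ If $\boldsymbol\rho\in\mathcal C$, where $\mathcal C$ is the interior of the convex hull of $\mathcal S$, then the associated queueing network process $(\mathbf Q(t):t\in\mathbb Z_+)$ is positive recurrent.
   Context: **Single class switched network.** $\mathcal J$ is a finite set of queues and time is discrete. *External arrivals.* The numbers of external arrivals per time unit at queue $j$ are $\mathbb Z_+$-valued, i.i.d. over time, independent across queues, with mean $a_j\in\mathbb R_+$. $E_j(t)$ is the total of the first $t$ of them. *Job sizes.* Job sizes at queue $j$ are geometric with parameter $p_j\in(0,1]$: each unit of service devoted to queue $j$ completes the job being served with probability $p_j$, independently. $S_j(u)$ is the number of jobs completed by $u$ units of service at queue $j$. *Routing.* A job completing service at $j$ moves to $j'$ with probability $P_{jj'}$ and leaves the network with probability $P_{j\omega}=1-\sum_{j'}P_{jj'}$, independently of everything else. $\Phi_{jj'}(d)$ is the number of the first $d$ departures from $j$ that are routed to $j'$. The matrix $\mathbf P=(P_{jj'})$ is the mean routing matrix, and the network is open: $I-\mathbf P$ is invertible. *Schedules.* $\mathcal S\subset\mathbb Z_+^{|\mathcal J|}$ is a finite set of feasible schedules such that $\boldsymbol\sigma\in\mathcal S$, $\boldsymbol\sigma'\in\mathbb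 Z_+^{|\mathcal J|}$ and $\boldsymbol\sigma'\le\boldsymbol\sigma$ coordinatewise imply $\boldsymbol\sigma'\in\mathcal S$. *Dynamics.* A policy assigns to each queue length vector $\mathbf Q$ a schedule $\boldsymbol\pi(\mathbf Q)\in\mathcal S$. When the policy is defined by an optimization problem, ties are broken arbitrarily or randomly, depending only on $\mathbf Q$. For $t\in\mathbb N$, $Q_j(t)=Q_j(0)+A_j(t)-D_j(t)$, $A_j(t)=E_j(t)+\sum_{j'}\Phi_{j'j}(D_{j'}(t))$, $D_j(t)=S_j(\Pi_j(t))$, $\Pi_j(t)=\sum_{\tau=0}^{t-1}\big(\pi_j(\mathbf Q(\tau))\wedge Q_j(\tau)\big)$. Thus in each step the jobs initially present are served first, and then arrivals join. $(\mathbf Q(t))$ is a discrete time countable state space Markov chain. *Traffic intensity.* $\boldsymbol\lambda=\mathbf a(I-\mathbf P)^{-1}$, i.e. $\lambda_j=a_j+\sum_{j'}\lambda_{j'}P_{j'j}$, and $\rho_j=\lambda_j/p_j$, $\boldsymbol\rho=(\rho_j)_{j\in\mathcal J}$. *)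

(* Defs.v *)
From HB Require Import structures.
From mathcomp Require Import all_boot all_order all_algebra finmap.
From mathcomp Require Import all_classical all_reals all_analysis.

Set Implicit Arguments.
Unset Strict Implicit.
Unset Printing Implicit Defensive.

Import Order.TTheory GRing.Theory Num.Theory.
Import numFieldNormedType.Exports.

Local Open Scope classical_set_scope.
Local Open Scope ring_scope.

(* Queues are indexed by 'I_n; a queue length vector or a schedule is an
   element of Z_+^n. *)
Definition nvec (n : nat) := {ffun 'I_n -> nat}.

Record network (R : realType) (n : nat) := Network {
  arrival_rate : 'rV[R]_n;
  completion_prob : 'I_n -> R;
  routing_mx : 'M[R]_n;
  schedules : {fset nvec n};
  arrival_rate_ge0 : forall j, 0 <= arrival_rate ord0 j;
  completion_prob_gt0 : forall j, 0 < completion_prob j;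
  completion_prob_le1 : forall j, completion_prob j <= 1;
  routing_mx_ge0 : forall j k, 0 <= routing_mx j k;
  routing_mx_le1 : forall j, \sum_k routing_mx j k <= 1;
  routing_mx_open : (1%:M - routing_mx) \in unitmx;
  schedules_down : forall s s' : nvec n,
    s \in schedules -> (forall j, s' j <= s j)%N -> s' \in schedules }.

(* [None] stands for leaving the network. *)
Definition routing_prob (R : realType) (n : nat) (N : network R n)
    (j : 'I_n) (k : option 'I_n) : R :=
  if k is Some j' then routing_mx N j j' else 1 - \sum_j' routing_mx N j j'.

Definition traffic (R : realType) (n : nat) (N : network R n) : 'rV[R]_n :=
  arrival_rate N *m invmx (1%:M - routing_mx N).

Definition load (R : realType) (n : nat) (N : network R n) : 'rV[R]_n :=
  \row_j (traffic N ord0 j / completion_prob N j).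

Definition rvec (R : realType) (n : nat) (s : nvec n) : 'rV[R]_n :=
  \row_j (s j)%:R.

Definition convex_hull (R : realType) (n : nat) (A : set 'rV[R]_n) :
    set 'rV[R]_n :=
  smallest (fun B : set 'rV[R]_n => convex_set B) A.

Definition capacity_region (R : realType) (n : nat) (N : network R n) :
    set 'rV[R]_n :=
  interior (convex_hull [set rvec R s | s in [set` schedules N]]).

(* Each [G i] is meant to be the sigma-algebra generated by one random
   element; finite subfamilies are enumerated by injections from 'I_m. *)
Definition mutually_independent (R : realType) (d : measure_display)
    (T : measurableType d) (P : probability T R) (I : Type)
    (G : I -> set_system T) : Prop :=
  (forall i, G i `<=` measurable) /\
  forall (m : nat) (i : 'I_m -> I) (A : 'I_m -> set T),
    injective i -> (forall k, G (i k) (A k)) ->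
    P (\bigcap_k A k) = (\prod_(k < m) P (A k))%E.

Inductive primitive_index (n : nat) :=
  | ArrivalIx of 'I_n & nat
  | ServiceIx of 'I_n & nat
  | RouteIx of 'I_n & nat
  | TieIx of nat.

Definition primitive_sigma (n : nat) (d : measure_display)
    (T : measurableType d) (dU : measure_display) (U : measurableType dU)
    (arr : 'I_n -> nat -> T -> nat) (svc : 'I_n -> nat -> T -> bool)
    (rte : 'I_n -> nat -> T -> option 'I_n) (tie : nat -> T -> U)
    (i : primitive_index n) : set_system T :=
  match i with
  | ArrivalIx j t => preimage_set_system setT (arr j t) setT
  | ServiceIx j u => preimage_set_system setT (svc j u) setT
  | RouteIx j m => preimage_set_system setT (rte j m) setT
  | TieIx t => preimage_set_system setT (tie t) measurable
  end.

(* [arr j t]: number of external arrivals at [j] in time slot [t];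
   [svc j u]: whether the [u]-th unit of service at [j] completes a job;
   [rte j m]: destination of the [m]-th departure from [j];
   [tie t]: auxiliary randomness available to the policy in slot [t].
   All counters start at 0. *)
Record primitives (R : realType) (n : nat) (N : network R n)
    (d : measure_display) (T : measurableType d) (P : probability T R)
    (dU : measure_display) (U : measurableType dU) := Primitives {
  arr : 'I_n -> nat -> T -> nat;
  svc : 'I_n -> nat -> T -> bool;
  rte : 'I_n -> nat -> T -> option 'I_n;
  tie : nat -> T -> U;
  primitives_indep : mutually_independent P (primitive_sigma arr svc rte tie);
  arr_ident : forall j t k,
    P [set w | arr j t w = k] = P [set w | arr j 0%N w = k];
  arr_mean : forall j,
    (\int[P]_w ((arr j 0%N w)%:R%:E) = (arrival_rate N ord0 j)%:E)%E;
  svc_law : forall j u, P [set w | svc j u w = true] = (completion_prob N j)%:E;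
  rte_law : forall j m k, P [set w | rte j m w = k] = (routing_prob N j k)%:E;
  tie_ident : forall t (B : set U), measurable B ->
    P (tie t @^-1` B) = P (tie 0%N @^-1` B) }.

(* A possibly randomized policy: at queue lengths [q] the schedule is [pi q u],
   where [u] is fresh randomness, so that its law depends on [q] only; [pi]
   constant in [u] is a deterministic policy. *)
Definition is_policy (R : realType) (n : nat) (N : network R n)
    (dU : measure_display) (U : measurableType dU)
    (pi : nvec n -> U -> nvec n) : Prop :=
  (forall q u, pi q u \in schedules N) /\
  (forall q s, measurable [set u | pi q u = s]).

Definition weighted_value (R : realType) (n : nat) (N : network R n)
    (q s : nvec n) : R :=
  \sum_j (q j)%:R * ((s j)%:R / load N ord0 j).

Definition weighted_maxweight (R : realType) (n : nat) (N : network R n)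
    (dU : measure_display) (U : measurableType dU)
    (pi : nvec n -> U -> nvec n) : Prop :=
  forall q u s, s \in schedules N ->
    weighted_value N q s <= weighted_value N q (pi q u).

Definition external (R : realType) (n : nat) (N : network R n)
    (d : measure_display) (T : measurableType d) (P : probability T R)
    (dU : measure_display) (U : measurableType dU)
    (X : primitives N P U) (j : 'I_n) (t : nat) (w : T) : nat :=
  (\sum_(s < t) arr X j s w)%N.

Definition completed (R : realType) (n : nat) (N : network R n)
    (d : measure_display) (T : measurableType d) (P : probability T R)
    (dU : measure_display) (U : measurableType dU)
    (X : primitives N P U) (j : 'I_n) (u : nat) (w : T) : nat :=
  (\sum_(v < u) svc X j v w)%N.

Definition routed (R : realType) (n : nat) (N : network R n)
    (d : measure_display) (T : measurableType d) (P : probability T R)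
    (dU : measure_display) (U : measurableType dU)
    (X : primitives N P U) (j k : 'I_n) (m : nat) (w : T) : nat :=
  (\sum_(i < m) (rte X j i w == Some k))%N.

(* Departures, arrivals and queue lengths at time [t] as functions of the
   cumulative service [S] up to [t], for initial queue lengths [x]. *)
Definition departures_of (R : realType) (n : nat) (N : network R n)
    (d : measure_display) (T : measurableType d) (P : probability T R)
    (dU : measure_display) (U : measurableType dU)
    (X : primitives N P U) (S : nvec n) (j : 'I_n) (w : T) : nat :=
  completed X j (S j) w.

Definition arrivals_of (R : realType) (n : nat) (N : network R n)
    (d : measure_display) (T : measurableType d) (P : probability T R)
    (dU : measure_display) (U : measurableType dU)
    (X : primitives N P U) (t : nat) (S : nvec n) (j : 'I_n) (w : T) : nat :=
  (external X j t w + \sum_k routed X k j (departures_of X S k w) w)%N.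

Definition queues_of (R : realType) (n : nat) (N : network R n)
    (d : measure_display) (T : measurableType d) (P : probability T R)
    (dU : measure_display) (U : measurableType dU)
    (X : primitives N P U) (x : nvec n) (t : nat) (S : nvec n) (w : T) :
    nvec n :=
  [ffun j => x j + arrivals_of X t S j w - departures_of X S j w]%N.

Fixpoint service (R : realType) (n : nat) (N : network R n)
    (d : measure_display) (T : measurableType d) (P : probability T R)
    (dU : measure_display) (U : measurableType dU)
    (X : primitives N P U) (pi : nvec n -> U -> nvec n)
    (x : nvec n) (t : nat) (w : T) {struct t} : nvec n :=
  if t is t'.+1 then
    let S := service X pi x t' w in
    let q := queues_of X x t' S w in
    [ffun j => S j + minn (pi q (tie X t' w) j) (q j)]%N
  else [ffun=> 0%N].

Definition departures (R : realType) (n : nat) (N : network R n)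
    (d : measure_display) (T : measurableType d) (P : probability T R)
    (dU : measure_display) (U : measurableType dU)
    (X : primitives N P U) (pi : nvec n -> U -> nvec n)
    (x : nvec n) (t : nat) (j : 'I_n) (w : T) : nat :=
  departures_of X (service X pi x t w) j w.

Definition arrivals (R : realType) (n : nat) (N : network R n)
    (d : measure_display) (T : measurableType d) (P : probability T R)
    (dU : measure_display) (U : measurableType dU)
    (X : primitives N P U) (pi : nvec n -> U -> nvec n)
    (x : nvec n) (t : nat) (j : 'I_n) (w : T) : nat :=
  arrivals_of X t (service X pi x t w) j w.

(* The queueing network process started at [x]. *)
Definition queue_process (R : realType) (n : nat) (N : network R n)
    (d : measure_display) (T : measurableType d) (P : probability T R)
    (dU : measure_display) (U : measurableType dU)
    (X : primitives N P U) (pi : nvec n -> U -> nvec n)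
    (x : nvec n) (t : nat) (w : T) : nvec n :=
  queues_of X x t (service X pi x t w) w.

Lemma serviceE (R : realType) (n : nat) (N : network R n)
    (d : measure_display) (T : measurableType d) (P : probability T R)
    (dU : measure_display) (U : measurableType dU)
    (X : primitives N P U) (pi : nvec n -> U -> nvec n)
    (x : nvec n) (t : nat) (j : 'I_n) (w : T) :
  service X pi x t w j =
  (\sum_(s < t) minn (pi (queue_process X pi x s w) (tie X s w) j)
                     (queue_process X pi x s w j))%N.
Proof.
elim: t => [|t IH]; first by rewrite /= ffunE big_ord0.
by rewrite big_ord_recr /= ffunE IH.
Qed.

Lemma leq_completed (R : realType) (n : nat) (N : network R n)
    (d : measure_display) (T : measurableType d) (P : probability T R)
    (dU : measure_display) (U : measurableType dU)
    (X : primitives N P U) (j : 'I_n) (u v : nat) (w : T) :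
  (completed X j (u + v) w <= completed X j u w + v)%N.
Proof.
elim: v => [|v IH]; first by rewrite !addn0.
rewrite addnS /completed big_ord_recr /= addnS -addn1.
by apply: leq_add; [exact: IH | exact: leq_b1].
Qed.

Lemma leq_departures (R : realType) (n : nat) (N : network R n)
    (d : measure_display) (T : measurableType d) (P : probability T R)
    (dU : measure_display) (U : measurableType dU)
    (X : primitives N P U) (pi : nvec n -> U -> nvec n)
    (x : nvec n) (t : nat) (j : 'I_n) (w : T) :
  (departures X pi x t j w <= x j + arrivals X pi x t j w)%N.
Proof.
have mono m (f : nat -> nat) k : (m <= k ->
    \sum_(i < m) f i <= \sum_(i < k) f i)%N.
  move=> mk; rewrite -(big_mkord xpredT) -[X in (_ <= X)%N](big_mkord xpredT).
  by rewrite [X in (_ <= X)%N](big_cat_nat (n := m)) //= leq_addr.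
elim: t => [|t IH].
  by rewrite /departures /departures_of /= ffunE /completed big_ord0.
have arr_le : (arrivals X pi x t j w <= arrivals X pi x t.+1 j w)%N.
  rewrite /arrivals /arrivals_of; apply: leq_add.
    by rewrite /external (mono _ (fun s => arr X j s w)).
  apply: leq_sum => k _; rewrite /routed.
  rewrite (mono _ (fun i => (rte X k i w == Some j) : nat)) //.
  rewrite /departures_of /completed (mono _ (fun i => svc X k i w : nat)) //.
  by rewrite /= ffunE leq_addr.
apply: leq_trans (_ : _ <= x j + arrivals X pi x t j w)%N _;
  last by rewrite leq_add2l.
rewrite /departures /departures_of /= ffunE.
apply: leq_trans (leq_completed _ _ _ _ _) _.
apply: (@leq_trans (departures X pi x t j w + queue_process X pi x t w j)%N).
  by rewrite leq_add2l geq_minr.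
by rewrite /queue_process ffunE -/(arrivals _ _ _ _ _ _)
  -/(departures _ _ _ _ _ _) subnKC.
Qed.

(* The truncated subtraction in [queues_of] is never truncated. *)
Lemma queue_processE (R : realType) (n : nat) (N : network R n)
    (d : measure_display) (T : measurableType d) (P : probability T R)
    (dU : measure_display) (U : measurableType dU)
    (X : primitives N P U) (pi : nvec n -> U -> nvec n)
    (x : nvec n) (t : nat) (j : 'I_n) (w : T) :
  (queue_process X pi x t w j + departures X pi x t j w =
   x j + arrivals X pi x t j w)%N.
Proof. by rewrite ffunE subnK //; exact: leq_departures. Qed.

(* inf {t >= 1 : Q_x(t) \in F}, equal to +oo if F is never reached *)
Definition return_time (R : realType) (St T : Type) (Q : St -> nat -> T -> St)
    (F : set St) (x : St) (w : T) : \bar R :=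
  ereal_inf [set (t%:R)%:E | t in [set t : nat | (0 < t)%N /\ F (Q x t w)]].

Definition mean_return_time (R : realType) (St : Type) (d : measure_display)
    (T : measurableType d) (P : probability T R) (Q : St -> nat -> T -> St)
    (F : set St) (x : St) : \bar R :=
  (\int[P]_w return_time R Q F x w)%E.

(* [Q x] is the chain started at [x]. *)
Definition positive_recurrent_state (R : realType) (St : Type)
    (d : measure_display) (T : measurableType d) (P : probability T R)
    (Q : St -> nat -> T -> St) (y : St) : Prop :=
  (mean_return_time P Q [set y] y < +oo)%E.

(* Irreducibility is not assumed (arrivals may for instance be deterministic),
   so transient states and several closed classes are possible. For an
   irreducible chain the condition says that all states are positive
   recurrent. *)
Definition positive_recurrent (R : realType) (St : Type)
    (d : measure_display) (T : measurableType d) (P : probability T R)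
    (Q : St -> nat -> T -> St) : Prop :=
  exists F : set St,
    [/\ finite_set F,
        forall y, F y -> positive_recurrent_state P Q y &
        forall x, (mean_return_time P Q F x < +oo)%E].

(* Main.v *)
(* Write y_s = (s_j / rho_j - 1)_j for a schedule s, and let q be the queue
   lengths. The mean drift in a direction g is - B(g, y_s), where s is the
   schedule actually served and B is the form of [flow_mx]; by the traffic
   equations 2 B(y, y) is a Dirichlet form, positive for y != 0 because the
   network is open. In the fluid limit V(q) = max_s q . y_s is a Lyapunov
   function: it decreases at rate B(y_s, y_s) for a maximizer s, and V(q) grows
   linearly because rho is interior to the hull.
     At the kinks of V a single step need not decrease V, so V is replaced by a
   soft maximum of affine functions q . g_F + b_F over sets F of schedules. By a
   theorem of the alternative, if some q has q . y_s > 0 for all s in F, then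
   there is g_F in the convex hull of the y_s with B(g_F, y_s) > 0 for all s in
   F. Offsets b_F growing fast enough with the cardinal of F make only those F
   count that contain all near-maximizers at q, hence the schedule served.
   Arrivals have only a first moment, but the soft maximum has linear growth,
   and its second-order remainder 4 M min(1, beta M) has small mean for small
   beta.
     Foster's criterion bounds the time to reach a finite set C. As the chain
   need not be irreducible, the finite set of the conclusion consists of the
   states of C that are maximal for reachability; adding to the Lyapunov
   function a multiple of a truncated mean hitting time extends the criterion
   to these targets. The Markov property holds because, given the cumulative
   services and departures, past and future depend on disjoint families of
   primitives. *)

Require Import Defs.
From HB Require Import structures.
From mathcomp Require Import all_boot all_order all_algebra finmap.
From mathcomp Require Import all_classical all_reals all_analysis.
From mathcomp Require Import measurable_realfun ring lra.

Set Implicit Arguments.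
Unset Strict Implicit.
Unset Printing Implicit Defensive.

Import Order.TTheory GRing.Theory Num.Theory.
Import numFieldNormedType.Exports.

Local Open Scope classical_set_scope.
Local Open Scope ring_scope.

(** * Linear inequalities *)

(** Positive combinations of at least one generator, so that the zero combination is excluded.
    Vectors are functions on [nat], so that elimination lowers [m] without a change of type. *)
Inductive conic (R : realFieldType) (s : seq (nat -> R)) : (nat -> R) -> Prop :=
  | conic_mem v of v \in s : conic s v
  | conicD u v of conic s u & conic s v : conic s (fun i => u i + v i)
  | conicZ c v of 0 < c & conic s v : conic s (fun i => c * v i).

Lemma exists_between (R : realFieldType) (A B : seq R) :
  (forall b, b \in B -> 0 < b) -> (forall a b, a \in A -> b \in B -> a < b) ->
  exists x, [/\ 0 < x, forall a, a \in A -> a < x & forall b, b \in B -> x < b].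
Proof.
(* The default 0 makes positivity one more lower bound; the default [a0 + 1] below covers an empty
   [B]. *)
move=> B0 AB; pose a0 := \big[Order.max/0]_(a <- A) a.
pose b0 := \big[Order.min/a0 + 1]_(b <- B) b.
have a0ge a : a \in A -> a <= a0 by move=> aA; exact: le_bigmax_seq.
have a00 : 0 <= a0 by exact: bigmax_ge_id.
have b0le b : b \in B -> b0 <= b by move=> bB; exact: ge_bigmin_seq.
have ab0 : a0 < b0.
  rewrite /b0 big_seq; apply: lt_bigmin; first by rewrite ltrDl.
  move=> b bB; rewrite /a0 big_seq; apply: bigmax_lt; first exact: B0.
  by move=> a aA; exact: AB.
exists ((a0 + b0) / 2); split.
- by lra.
- by move=> a /a0ge; lra.
- by move=> b /b0le; lra.
Qed.

(* Fourier-Motzkin elimination of the last coordinate. *)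
Lemma exists_positive_functional (R : realFieldType) (m : nat)
    (s : seq (nat -> R)) :
  (forall v, conic s v -> exists2 i, (i < m)%N & 0 < v i) ->
  exists w : nat -> R, (forall i, 0 < w i) /\
    forall v, v \in s -> 0 < \sum_(i < m) w i * v i.
Proof.
elim: m s => [|m IH] s Hs.
  exists (fun=> 1); split => // v /conic_mem /Hs [].
  by [].
(* [comb] cancels coordinate [m] of two vectors with opposite signs there. Keeping the vectors
   negative at [m] makes the upper bounds that they impose positive. *)
pose comb (u v : nat -> R) := fun i => - v m * u i + u m * v i.
pose P := [seq u <- s | 0 < u m]; pose N := [seq v <- s | v m < 0].
pose s' := [seq v <- s | v m <= 0] ++ [seq comb u v | u <- P, v <- N].
have s'P v : conic s' v -> conic s v /\ v m <= 0.
  elim=> {v} [v|u v _ [cu um] _ [cv vm]|c v c0 _ [cv vm]].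
  - rewrite mem_cat mem_filter => /orP[/andP[vm vs]|].
      by split => //; exact: conic_mem.
    move=> /allpairsP[[u1 v1] /= []].
    rewrite !mem_filter => /andP[um us] /andP[vm vs] ->; split.
      apply: (@conicD _ _ (fun i => - v1 m * u1 i) (fun i => u1 m * v1 i)).
        by apply: conicZ; [rewrite oppr_gt0 | exact: conic_mem].
      by apply: conicZ => //; exact: conic_mem.
    by rewrite (_ : comb u1 v1 m = 0)// /comb; ring.
  - by split; [exact: conicD | rewrite -(addr0 0) lerD].
  - by split; [exact: conicZ | rewrite pmulr_rle0].
have [v /s'P[cv vm]|w [w0 Hw]] := IH s'.
  have [i im vi] := Hs _ cv; exists i => //.
  have : i != m by apply: contraTneq vi => ->; rewrite -leNgt.
  by move=> ?; rewrite ltn_neqAle -ltnS im andbT.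
pose S (v : nat -> R) := \sum_(i < m) w i * v i.
(* [x] will be the weight of coordinate [m]: vectors positive there bound it from below, negative
   ones from above, and the vectors [comb u v] make these bounds compatible. *)
have [||x [x0 Px Nx]] := @exists_between R [seq - S u / u m | u <- P]
    [seq S v / - v m | v <- N].
- move=> _ /mapP[v vN ->]; move: (vN); rewrite mem_filter => /andP[vm vs].
  rewrite divr_gt0 ?oppr_gt0// Hw// mem_cat mem_filter (ltW vm) vs.
  by [].
- move=> _ _ /mapP[u uP ->] /mapP[v vN ->].
  move: (uP) (vN); rewrite !mem_filter => /andP[um us] /andP[vm vs].
  have : 0 < S (comb u v).
    by rewrite Hw// mem_cat; apply/orP; right; apply/allpairsP; exists (u, v).
  have -> : S (comb u v) = - v m * S u + u m * S v.
    rewrite /S !mulr_sumr -big_split; apply: eq_bigr => i _.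
    by rewrite /comb /=; ring.
  rewrite ltr_pdivlMr ?oppr_gt0// mulrAC ltr_pdivrMr//.
  lra.
exists (fun i => if i == m then x else w i); split.
  by move=> i; case: ifP.
move=> v vs; rewrite big_ord_recr /= eqxx.
have -> : \sum_(i < m) (if nat_of_ord i == m then x else w i) * v i = S v.
  by apply: eq_bigr => i _; rewrite ltn_eqF.
have [vm|vm|vm] := ltgtP (v m) 0.
- have : x < S v / - v m by apply/Nx/map_f; rewrite mem_filter vm.
  by rewrite ltr_pdivlMr ?oppr_gt0//; lra.
- have : - S v / v m < x by apply/Px/map_f; rewrite mem_filter vm.
  by rewrite ltr_pdivrMr//; lra.
- by rewrite vm mulr0 addr0 Hw// mem_cat mem_filter vm lexx vs.
Qed.

(** The theorem of the alternative for the columns of [M]: an element of their cone is [M z] with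
    [z] nonnegative and nonzero on [F]. The functional found is then normalized. *)
Lemma copositive_weights (R : realFieldType) (I : finType) (F : {set I})
    (M : I -> I -> R) (i0 : I) : i0 \in F ->
  (forall z : I -> R, (forall i, 0 <= z i) -> (exists2 i, i \in F & 0 < z i) ->
    exists2 i, i \in F & 0 < \sum_(j in F) M i j * z j) ->
  exists w : I -> R, [/\ forall i, i \in F -> 0 < w i,
    \sum_(i in F) w i = 1 &
    forall j, j \in F -> 0 < \sum_(i in F) w i * M i j].
Proof.
move=> i0F HM.
pose e k := nth i0 (enum F) k.
have eE (f : I -> R) : \sum_(i in F) f i = \sum_(k < #|F|) f (e k).
  by rewrite -big_enum /= (big_nth i0) -cardE big_mkord.
have eF k : (k < #|F|)%N -> e k \in F.
  by rewrite cardE => kF; rewrite -mem_enum mem_nth.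
pose s := [seq (fun k => M (e k) j) | j <- enum F].
have sP v : conic s v -> exists z : I -> R, [/\ forall i, 0 <= z i,
    exists2 i, i \in F & 0 < z i &
    forall k, v k = \sum_(j in F) M (e k) j * z j].
  elim=> {v} [v /mapP[j jF ->]|u v _ [z [z0 zF zE]] _ [z' [z'0 z'F z'E]]|].
  - rewrite mem_enum in jF.
    exists (fun i => (i == j)%:R); split => [i||k]; first by rewrite ler0n.
      by exists j => //; rewrite eqxx.
    rewrite (bigD1 j)//= eqxx mulr1 big1 ?addr0// => i /andP[_ /negbTE ->].
    by rewrite mulr0.
  - exists (fun i => z i + z' i); split => [i||k]; first by rewrite addr_ge0.
      by have [i iF zi] := zF; exists i => //; rewrite ltr_pwDl.
    by rewrite zE z'E -big_split /=; apply: eq_bigr => j _; rewrite mulrDr.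
  - move=> c v c0 _ [z [z0 [i iF zi] zE]]; exists (fun i => c * z i); split.
    + by move=> ?; rewrite mulr_ge0// ltW.
    + by exists i => //; rewrite mulr_gt0.
    + by move=> k; rewrite zE mulr_sumr; apply: eq_bigr => j _; rewrite mulrCA.
have [v /sP[z [z0 zF zE]]|w [w0 Hw]] := @exists_positive_functional R #|F| s.
  have [i iF Mi] := HM _ z0 zF; exists (index i (enum F)).
    by rewrite cardE index_mem mem_enum.
  by rewrite zE /e nth_index ?mem_enum.
have W0 : 0 < \sum_(k < #|F|) w k.
  have Fgt0 : (0 < #|F|)%N by apply/card_gt0P; exists i0.
  rewrite (bigD1 (Ordinal Fgt0))//= ltr_pwDl// sumr_ge0// => k _.
  exact: ltW.
exists (fun i => w (index i (enum F)) / \sum_(k < #|F|) w k).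
have idx k : (k < #|F|)%N -> index (e k) (enum F) = k.
  by rewrite cardE => kF; rewrite index_uniq ?enum_uniq.
split => [i iF||j jF].
- exact: divr_gt0.
- rewrite -mulr_suml eE; under eq_bigr => k _ do rewrite idx//.
  by rewrite divff// gt_eqF.
- rewrite eE; under eq_bigr => k _ do rewrite idx// mulrAC.
  rewrite -mulr_suml divr_gt0//.
  apply: (Hw (fun k => M (e k) j)); apply/mapP; exists j => //.
  by rewrite mem_enum.
Qed.
(** * The Lyapunov function *)

(* If [F] misses the near-maximizer [v], then either the mean of [val] over [F]
   is far below the maximum, or all of [F] is within [theta (b #|F|)] of it, and
   then the set of all such indices is larger than [F] and wins by its offset. *)
Lemma hierarchical_offsets (R : realFieldType) (I : finType)
    (good : pred {set I}) (wt : {set I} -> I -> R) (wmin kappa K : R) :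
  0 < wmin -> 0 <= kappa -> 0 <= K ->
  (forall F i, good F -> i \in F -> wmin <= wt F i) ->
  (forall F, good F -> \sum_(i in F) wt F i = 1) ->
  exists (b : nat -> R) (thr : R), forall (val : I -> R) (i0 : I),
    (forall i, val i <= val i0) -> thr <= val i0 ->
    (forall (F : {set I}) i1, i1 \in F -> (forall i, i \in F -> 0 < val i) ->
       good F) ->
    let l F := if good F then \sum_(i in F) wt F i * val i + b #|F| else 0 in
    forall v F, val i0 - kappa <= val v -> (good F -> v \notin F) ->
    exists F', l F + K <= l F'.
Proof.
move=> wmin0 kappa0 K0 wtge wt1.
(* Dividing by [wmin] makes one element [theta x] below the maximum cost the mean at least [x + K];
   the summand [kappa] keeps [v] within [theta x] of the maximum. The recursion for [b] makes the
   offset of a larger set pay for [theta] and for the margin [K]. *)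
pose theta x := (x + K) / wmin + kappa.
pose b := fix b f := if f is f'.+1 then b f' + theta (b f') + K else 0.
have b0 f : 0 <= b f.
  elim: f => //= f IH; rewrite !addr_ge0//.
  by rewrite divr_ge0 ?(ltW wmin0)// addr_ge0.
have theta0 f : 0 <= theta (b f).
  by rewrite /theta !addr_ge0// divr_ge0 ?(ltW wmin0)// addr_ge0.
have bmono f g : (f <= g)%N -> b f <= b g.
  move=> /subnK <-; elim: (g - f)%N => //= h IH.
  by rewrite -addrA ler_wpDr// addr_ge0.
(* A maximum above this threshold exceeds each [theta (b f)], so that near-maximizers have positive
   values and form a good set, and it exceeds [K], so that it beats the value 0 of a bad set. *)
exists b, (K + kappa + 1 + \sum_(f < #|I|.+1) theta (b f)).
move=> val i0 top; set Th := (X in X <= _) => Thtop goodP l v F gapv vF.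
have thTh f : (f <= #|I|)%N -> theta (b f) < Th.
  move=> fI; rewrite /Th (bigD1 (Ordinal (fI : (f < #|I|.+1)%N)))//=.
  have : 0 <= \sum_(i < #|I|.+1 | i != Ordinal (fI : (f < #|I|.+1)%N))
    theta (b i) by apply: sumr_ge0 => *; exact: theta0.
  by lra.
have top0 : 0 < val i0 by rewrite (lt_le_trans _ Thtop)// (le_lt_trans _ (thTh 0%N _)).
have ThK : K <= Th by have : 0 <= \sum_(f < #|I|.+1) theta (b f)
   by [apply: sumr_ge0 => *; exact: theta0]; rewrite /Th; lra.
have gi0 : good [set i0]%SET.
  by apply: (goodP _ i0); rewrite ?inE// => i /set1P ->.
have l_i0 : val i0 <= l [set i0]%SET.
  rewrite /l gi0; have := wt1 _ gi0; rewrite !big_set1 => ->.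
  by rewrite mul1r lerDl.
have [gF|bF] := boolP (good F); last first.
  by exists [set i0]%SET; rewrite {1}/l (negbTE bF) add0r (le_trans _ l_i0)// (le_trans ThK).
pose G := [set i | val i0 - theta (b #|F|) <= val i]%SET.
have gG : good G.
  apply: (goodP _ i0); first by rewrite inE gerBl theta0.
  move=> i; rewrite inE; apply: lt_le_trans; rewrite subr_gt0.
  by rewrite (lt_le_trans _ Thtop)// thTh// max_card.
have lF : l F = \sum_(i in F) wt F i * val i + b #|F| by rewrite /l gF.
have wtpos i : i \in F -> 0 <= wt F i.
  by move=> iF; rewrite (le_trans (ltW wmin0))// wtge.
have [FG|/subsetPn[i iF]] := boolP (F \subset G).
  exists G; have ltFG : (#|F| < #|G|)%N.
    have vG : v \in G.
      rewrite inE (le_trans _ gapv)// lerD2l lerN2 /theta lerDr.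
      by rewrite divr_ge0 ?(ltW wmin0)// addr_ge0.
    apply: proper_card; apply/properP; split => //; exists v => //.
    exact: vF.
  have lFle : l F <= val i0 + b #|F|.
    rewrite lF lerD2r -[leRHS]mul1r -(wt1 _ gF) mulr_suml.
    by apply: ler_sum => i iF; rewrite ler_wpM2l// wtpos.
  have lGge : val i0 - theta (b #|F|) + b #|G| <= l G.
    rewrite /l gG lerD2r -[leLHS]mul1r -(wt1 _ gG) mulr_suml.
    apply: ler_sum => i iG; rewrite ler_wpM2l//.
      by rewrite (le_trans (ltW wmin0))// wtge.
    by move: iG; rewrite inE.
  by have := bmono _ _ ltFG; rewrite /=; lra.
rewrite inE -ltNge => gapi; exists [set i0]%SET; apply: le_trans l_i0.
have : l F <= val i0 - wmin * theta (b #|F|) + b #|F|.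
  rewrite lF lerD2r (bigD1 i)//=.
  have rest : \sum_(j in F | j != i) wt F j * val j <=
      \sum_(j in F | j != i) wt F j * val i0.
    by apply: ler_sum => j /andP[jF _]; rewrite ler_wpM2l// wtpos.
  have := wt1 _ gF; rewrite (bigD1 i)//= => wt1i.
  rewrite -mulr_suml in rest.
  have wtith : wmin * theta (b #|F|) <= wt F i * (val i0 - val i).
    by apply: ler_pM; rewrite ?(ltW wmin0)// ?wtge//; lra.
  have : val i0 = (wt F i + \sum_(j in F | j != i) wt F j) * val i0.
    by rewrite wt1i mul1r.
  by lra.
have : wmin * theta (b #|F|) = b #|F| + K + wmin * kappa.
  by rewrite /theta mulrDr mulrCA divff ?mulr1// gt_eqF.
have : 0 <= wmin * kappa by rewrite mulr_ge0// ltW.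
by lra.
Qed.

(** * Soft maximum of finitely many numbers *)

Section Softmax.
Variables (R : realType) (J : finType) (beta : R).

Definition partition_function (l : J -> R) : R := \sum_j expR (beta * l j).

Definition softmax (l : J -> R) : R := beta^-1 * ln (partition_function l).

(** The gradient of [softmax] at [l]. *)
Definition softmax_weight (l : J -> R) (j : J) : R :=
  expR (beta * l j) / partition_function l.

Hypothesis beta_gt0 : 0 < beta.

Lemma partition_function_gt0 l (j : J) : 0 < partition_function l.
Proof.
by rewrite /partition_function (bigD1 j)//= ltr_pwDl ?expR_gt0// sumr_ge0.
Qed.

Lemma softmax_ge0 l (j : J) : 0 <= l j -> 0 <= softmax l.
Proof.
move=> lj; rewrite mulr_ge0 ?invr_ge0 ?(ltW beta_gt0)// ln_ge0//.
rewrite /partition_function (bigD1 j)//= ler_wpDr//.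
  by rewrite sumr_ge0.
by rewrite -expR0 ler_expR mulr_ge0// ltW.
Qed.

Lemma softmax_weight_ge0 l j : 0 <= softmax_weight l j.
Proof.
by rewrite divr_ge0 ?expR_ge0// sumr_ge0.
Qed.

Lemma sum_softmax_weight l (j : J) : \sum_k softmax_weight l k = 1.
Proof. by rewrite -mulr_suml divff// gt_eqF// partition_function_gt0. Qed.

Lemma softmax_weight_le l (j k : J) (K : R) :
  l j + K <= l k -> softmax_weight l j <= expR (- (beta * K)).
Proof.
move=> ljk; rewrite ler_pdivrMr ?partition_function_gt0//.
rewrite /partition_function (bigD1 k)//= mulrDr ler_wpDr//.
  by rewrite mulr_ge0 ?expR_ge0// sumr_ge0.
by rewrite -expRD ler_expR -mulrN -mulrDr ler_pM2l//; lra.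
Qed.

(** From [1 - z <= expR (- z)], [expR z] is at most [(1 - z)^-1]; and [1 + z + 2 * z ^+ 2] times
    [1 - z] is [1 + z ^+ 2 * (1 - 2 * z)], at least 1. *)
Lemma expR_le_quadratic (z : R) : `|z| <= 2^-1 -> expR z <= 1 + z + 2 * z ^+ 2.
Proof.
rewrite ler_norml => /andP[zl zu]; have := expR_ge1Dx (- z) => ez.
have : expR z <= (1 - z)^-1.
  by rewrite -[expR z]invrK -expRN lef_pV2 ?posrE ?expR_gt0//; lra.
move=> /le_trans; apply; rewrite -[leLHS]mul1r ler_pdivrMr; last by lra.
have : 0 <= z ^+ 2 * (1 - 2 * z) by rewrite mulr_ge0 ?sqr_ge0//; lra.
by lra.
Qed.

(* Linear in [M] for large [M], so that a first moment of [M] suffices. *)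
Lemma softmax_increment l (x : J -> R) (M : R) (j : J) :
  (forall k, `|x k| <= M) ->
  softmax (fun k => l k + x k) <=
    softmax l + \sum_k softmax_weight l k * x k
    + 4 * M * Order.min 1 (beta * M).
Proof.
move=> xM; set p := softmax_weight l.
have M0 : 0 <= M by exact: le_trans (normr_ge0 (x j)) (xM j).
have Z0 := partition_function_gt0 l j.
(* [A] is also the ratio of the new partition function to the old one, so that the increment is
   [beta^-1 * ln A]. *)
pose A := \sum_k p k * expR (beta * x k).
have A0 : 0 < A.
  suff -> : A = partition_function (fun k => l k + x k) / partition_function l.
    by rewrite divr_gt0// partition_function_gt0.
  rewrite mulr_suml; apply: eq_bigr => k _.
  by rewrite mulrDr expRD mulrAC.
have -> : softmax (fun k => l k + x k) = softmax l + beta^-1 * ln A.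
  rewrite /softmax -mulrDr -lnM ?posrE//; congr (_ * ln _).
  rewrite mulr_sumr; apply: eq_bigr => k _.
  by rewrite mulrDr expRD mulrA mulrCA divff ?mulr1// gt_eqF.
rewrite -addrA lerD2l.
have p1 : \sum_k p k = 1 by exact: sum_softmax_weight j.
have p0 k : 0 <= p k by exact: softmax_weight_ge0.
have bnd : `|\sum_k p k * x k| <= M.
  apply: le_trans (ler_norm_sum _ _ _) _; rewrite -[M]mul1r -p1 mulr_suml.
  by apply: ler_sum => k _; rewrite normrM ger0_norm// ler_wpM2l.
(* For small [beta * M] the quadratic bound on the exponential applies. Otherwise the increment is
   at most [M] and the linear term at least [- M]; their gap [2 * M] is covered because the minimum
   is at least one half. *)
have [bM|bM] := leP (beta * M) 2^-1.
  have -> : Order.min 1 (beta * M) = beta * M by apply/min_idPr; lra.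
  have Ale : A <= 1 + (beta * (\sum_k p k * x k) + 2 * (beta * M) ^+ 2).
    have -> : 1 + (beta * (\sum_k p k * x k) + 2 * (beta * M) ^+ 2) =
        \sum_k p k * (1 + beta * x k + 2 * (beta * M) ^+ 2).
      rewrite [RHS](eq_bigr (fun k => p k + beta * (p k * x k)
          + p k * (2 * (beta * M) ^+ 2))); last by move=> k _; ring.
      by rewrite !big_split /= -[X in _ = _ + X]mulr_suml p1 mul1r -mulr_sumr addrA.
    apply: ler_sum => k _; rewrite ler_wpM2l//.
    have bx : `|beta * x k| <= beta * M.
      by rewrite normrM gtr0_norm// ler_pM2l.
    apply: le_trans (expR_le_quadratic (le_trans bx bM)) _.
    rewrite lerD2l ler_pM2l// -[leLHS]real_normK ?num_real//.
    by rewrite lerXn2r ?nnegrE// (le_trans _ bx).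
  have lnA : ln A <= beta * (\sum_k p k * x k) + 2 * (beta * M) ^+ 2.
    apply: le_trans (le_ln1Dx _ ); last by move: Ale A0; lra.
    by rewrite ler_ln ?posrE// (lt_le_trans A0).
  rewrite mulrC ler_pdivrMr//; apply: le_trans lnA _.
  have : 0 <= beta * (beta * M * M) by rewrite !mulr_ge0// ltW.
  by rewrite expr2; lra.
have Ale : A <= expR (beta * M).
  rewrite -[leRHS]mul1r -p1 mulr_suml; apply: ler_sum => k _.
  rewrite ler_wpM2l// ler_expR ler_pM2l//.
  by rewrite (le_trans (ler_norm _)).
have lnA : ln A <= beta * M.
  by rewrite -[leRHS]expRK ler_ln ?posrE ?expR_gt0.
have {}lnA : beta^-1 * ln A <= M by rewrite mulrC ler_pdivrMr// [M * _]mulrC.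
have : 2 * M <= 4 * M * Order.min 1 (beta * M).
  have -> : 2 * M = 4 * M * 2^-1 by rewrite mulrAC; congr (_ * _); lra.
  by rewrite ler_wpM2l ?mulr_ge0// le_min; apply/andP; split; lra.
by move: bnd; rewrite ler_norml => /andP[+ _]; lra.
Qed.

End Softmax.

(** * Bilinear forms and directions of the Lyapunov function *)

Definition bilin (R : pzRingType) (n : nat) (A : 'M[R]_n) (g y : 'rV[R]_n) : R :=
  (g *m A *m y^T) ord0 ord0.

Section Bilinear.
Variables (R : comNzRingType) (n : nat) (A : 'M[R]_n).
Implicit Types g y : 'rV[R]_n.

Lemma bilinE g y : bilin A g y = \sum_j \sum_k g ord0 j * A j k * y ord0 k.
Proof.
rewrite exchange_big /bilin mxE; apply: eq_bigr => k _.
by rewrite !mxE mulr_suml.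
Qed.

Lemma bilin_suml (I : Type) (s : seq I) (P : pred I) (c : I -> R)
    (g : I -> 'rV[R]_n) y :
  bilin A (\sum_(i <- s | P i) c i *: g i) y =
  \sum_(i <- s | P i) c i * bilin A (g i) y.
Proof.
rewrite /bilin !mulmx_suml summxE; apply: eq_bigr => i _.
by rewrite -!scalemxAl !mxE.
Qed.

Lemma bilin_sumr (I : Type) (s : seq I) (P : pred I) (c : I -> R)
    (y : I -> 'rV[R]_n) g :
  bilin A g (\sum_(i <- s | P i) c i *: y i) =
  \sum_(i <- s | P i) c i * bilin A g (y i).
Proof.
rewrite /bilin linear_sum mulmx_sumr summxE; apply: eq_bigr => i _.
by rewrite linearZ /= -scalemxAr !mxE.
Qed.

End Bilinear.

Definition dotv (R : pzRingType) (n : nat) (q g : 'rV[R]_n) : R :=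
  bilin 1%:M q g.

Lemma dotvE (R : comNzRingType) (n : nat) (q g : 'rV[R]_n) :
  dotv q g = \sum_j q ord0 j * g ord0 j.
Proof. by rewrite /dotv /bilin mulmx1 mxE; apply: eq_bigr => j _; rewrite !mxE. Qed.

Lemma bigmin_gt0 (R : realFieldType) (I : finType) (f : I -> R) :
  (forall i, 0 < f i) -> exists2 c, 0 < c & forall i, c <= f i.
Proof.
move=> f0; exists (\big[Order.min/1]_i f i).
  by apply: lt_bigmin => // i _; exact: f0.
by move=> i; exact: bigmin_le.
Qed.

(* [v] stands for the schedule served, which may lose [kappa] against the
   maximizer [i0] because short queues cannot use all the service offered. *)
Lemma lyapunov_directions (R : realType) (I : finType) (n : nat) (A : 'M[R]_n)
    (y : I -> 'rV[R]_n) (kappa : R) :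
  (forall x : 'rV[R]_n, x != 0 -> 0 < bilin A x x) -> 0 <= kappa ->
  exists (g : {set I} -> 'rV[R]_n) (c : R), 0 < c /\
  forall beta : R, 0 < beta -> exists (b : {set I} -> R) (thr : R),
    (exists F, g F = 0 /\ b F = 0) /\
    forall q i0 v, (forall i, dotv q (y i) <= dotv q (y i0)) ->
      thr <= dotv q (y i0) -> dotv q (y i0) - kappa <= dotv q (y v) ->
      c <= bilin A (\sum_F
        softmax_weight beta (fun F => dotv q (g F) + b F) F *: g F) (y v).
Proof.
move=> Apos kappa0.
pose positive (F : {set I}) := exists q, forall i, i \in F -> 0 < dotv q (y i).
pose good (F : {set I}) := (F != finset.set0) && `[<positive F>].
have wtP F : exists w : I -> R, good F -> [/\ forall i, i \in F -> 0 < w i,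
    \sum_(i in F) w i = 1 &
    forall j, j \in F -> 0 < bilin A (\sum_(i in F) w i *: y i) (y j)].
  have [/andP[/finset.set0Pn[i0 i0F] /asboolP[q qF]]|bF] := boolP (good F);
    last by exists (fun=> 0).
  have [z z0 [i iF zi]|w [w0 w1 wM]] :=
      @copositive_weights R I F (fun i j => bilin A (y i) (y j)) i0 i0F.
    (* [Y] is nonzero, as [q] shows. If every [bilin A (y i) Y] with [i] in [F] were nonpositive, so
       would be [bilin A Y Y]. *)
    pose Y := \sum_(j in F) z j *: y j.
    have qY : 0 < dotv q Y.
      rewrite /dotv bilin_sumr (bigD1 i)//= ltr_pwDl ?mulr_gt0 ?qF//.
      by apply: sumr_ge0 => j /andP[jF _]; rewrite mulr_ge0// ltW// qF.
    have Y0 : Y != 0.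
      apply: contraTneq qY => ->; rewrite dotvE big1 ?ltxx// => j _.
      by rewrite mxE mulr0.
    apply: contrapT => /forall2NP noti.
    have := Apos _ Y0; rewrite {1}/Y bilin_suml ltNge => /negP; apply.
    apply: sumr_le0 => k kF; apply: mulr_ge0_le0 => //.
    have [//|/negP] := noti k; rewrite -leNgt; apply: le_trans.
    rewrite /Y bilin_sumr; apply: ler_sum => j _.
    by rewrite mulrC.
  exists w => _; split => // j jF; rewrite bilin_suml; exact: wM.
have [wt {}wtP] := choice wtP.
pose g F := if good F then \sum_(i in F) wt F i *: y i else 0.
have [c0 c00 c0le] : exists2 c, 0 < c & forall p : {set I} * I,
    c <= if good p.1 && (p.2 \in p.1) then bilin A (g p.1) (y p.2) else 1.
  apply: bigmin_gt0 => -[F j] /=; case: ifP => // /andP[gF jF].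
  by rewrite /g gF; case: (wtP F gF) => _ _; exact.
have [wmin wmin0 wminle] : exists2 c, 0 < c & forall p : {set I} * I,
    c <= if good p.1 && (p.2 \in p.1) then wt p.1 p.2 else 1.
  apply: bigmin_gt0 => -[F j] /=; case: ifP => // /andP[gF jF].
  by case: (wtP F gF) => + _ _; exact.
pose C := \sum_(p : {set I} * I) `|bilin A (g p.1) (y p.2)|.
have C0 : 0 <= C by exact: sumr_ge0.
have Cge F j : - C <= bilin A (g F) (y j).
  rewrite lerNl /C (bigD1 (F, j))//= (le_trans (ler_norm _))// normrN lerDl.
  exact: sumr_ge0.
exists g, (c0 / 2); split; first by rewrite divr_gt0.
move=> beta beta0; set N : R := #|{set I}|%:R.
(* Chosen so that [N * (expR (- t) * (c0 + C))] is at most [c0 / 2], by [t <= expR t]. *)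
pose t := N * (c0 + C) * 2 / c0.
have t0 : 0 <= t by rewrite /t divr_ge0 ?(ltW c00)// !mulr_ge0// addr_ge0// ltW.
have K0 : 0 <= t / beta by rewrite divr_ge0// ltW.
have wtge F i : good F -> i \in F -> wmin <= wt F i.
  by move=> gF iF; have := wminle (F, i); rewrite /= gF iF.
have wt1 F : good F -> \sum_(i in F) wt F i = 1 by move=> /wtP[].
have [b [thr HT]] := hierarchical_offsets wmin0 kappa0 K0 wtge wt1.
exists (fun F => if good F then b #|F| else 0), thr; split.
  (* The empty set carries the zero affine function, which later makes the soft maximum
     nonnegative. *)
  have g0 : good finset.set0 = false by rewrite /good eqxx.
  by exists finset.set0; rewrite /g g0.
move=> q i0 v top Thtop gapv; set l := (fun F => _ + _).
have lE F : l F = if good F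
    then \sum_(i in F) wt F i * dotv q (y i) + b #|F| else 0.
  rewrite /l /g; case: ifP => _; first by rewrite /dotv bilin_sumr.
  by rewrite addr0 dotvE big1// => j _; rewrite mxE mulr0.
(* The margin [t / beta] in the offsets becomes the factor [expR (- t)] in the weights of all sets
   other than the good ones containing [v]. *)
have small F : (good F -> v \notin F) -> softmax_weight beta l F <= expR (- t).
  move=> vF; have [|F'] := HT _ i0 top Thtop _ v F gapv vF.
    move=> F1 i1 i1F F1pos; apply/andP; split.
      by apply/finset.set0Pn; exists i1.
    by apply/asboolP; exists q.
  rewrite -!lE => /(softmax_weight_le beta0).
  by rewrite mulrCA divff ?mulr1// gt_eqF.
(* Good sets containing [v] contribute at rate [c0] or more; any other set contributes at least
   [- C], with a small weight. *)
have term F : softmax_weight beta l F * c0 - expR (- t) * (c0 + C) <=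
    softmax_weight beta l F * bilin A (g F) (y v).
  have [/andP[gF vF]|] := boolP (good F && (v \in F)).
    have := c0le (F, v); rewrite /= gF vF => c0F.
    rewrite (@le_trans _ _ (softmax_weight beta l F * c0))//.
      by rewrite gerBl mulr_ge0 ?expR_ge0// addr_ge0// ltW.
    by rewrite ler_wpM2l// softmax_weight_ge0.
  rewrite negb_and -implybE => /implyP /small wle.
  have /(ler_wpM2l (softmax_weight_ge0 beta l F)) := Cge F v.
  have : softmax_weight beta l F * (c0 + C) <= expR (- t) * (c0 + C).
    by rewrite ler_wpM2r// addr_ge0// ltW.
  by lra.
rewrite bilin_suml; apply: le_trans (ler_sum _ (fun F _ => term F)).
rewrite big_split /= -mulr_suml (sum_softmax_weight _ _ finset.set0) mul1r.
rewrite sumr_const -[_ *+ _]mulr_natl -/N.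
suff : N * (expR (- t) * (c0 + C)) <= c0 / 2 by lra.
have et : t <= expR t by apply: le_trans (expR_ge1Dx t); lra.
rewrite mulrCA expRN mulrC ler_pdivrMr ?expR_gt0//.
have -> : N * (c0 + C) = c0 / 2 * t by rewrite /t; field; rewrite gt_eqF.
by rewrite ler_wpM2l// divr_ge0// ltW.
Qed.
(** * The drift form and the capacity region *)

Section NetworkAlgebra.
Variables (R : realType) (n : nat) (N : network R n).

Local Notation lam := (traffic N).
Local Notation rho := (load N).
Local Notation Pr := (routing_mx N).

(* For [g : 'rV_n] and the deviation [y] of the relative service rates from 1,
   [- bilin flow_mx g y] is the mean drift of the queues in direction [g]. *)
Definition flow_mx : 'M[R]_n :=
  \matrix_(j, k) (lam ord0 j * (j == k)%:R - lam ord0 k * Pr k j).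

Lemma traffic_eq j :
  arrival_rate N ord0 j + \sum_k lam ord0 k * Pr k j = lam ord0 j.
Proof.
have : lam *m (1%:M - Pr) = arrival_rate N.
  by rewrite /traffic mulmxKV// routing_mx_open.
rewrite mulmxBr mulmx1 => /(congr1 (fun v : 'rV_n => v ord0 j)).
by rewrite !mxE => <-; rewrite subrK.
Qed.

Lemma flow_mxE (g y : 'rV[R]_n) : bilin flow_mx g y =
  \sum_j g ord0 j * (lam ord0 j * y ord0 j - \sum_k lam ord0 k * Pr k j * y ord0 k).
Proof.
rewrite bilinE; apply: eq_bigr => j _.
under eq_bigr => k _ do rewrite -mulrA mxE.
rewrite -mulr_sumr; congr (_ * _).
under eq_bigr => k _ do rewrite mulrBl.
rewrite big_split /= sumrN; congr (_ - _).
rewrite (bigD1 j)//= eqxx mulr1 big1 ?addr0// => k /negbTE.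
by rewrite eq_sym => ->; rewrite mulr0 mul0r.
Qed.

(** The form is [D - E]. By the traffic equations the arrival sum is [D - D2]; the exit sum is
    [D - D1], and expanding the squares gives [D1 + D2 - 2 * E] for the transfers. *)
Lemma flow_mx_dirichlet (y : 'rV[R]_n) : 2 * bilin flow_mx y y =
  \sum_j arrival_rate N ord0 j * y ord0 j ^+ 2 +
  \sum_k lam ord0 k * (1 - \sum_j Pr k j) * y ord0 k ^+ 2 +
  \sum_k \sum_j lam ord0 k * Pr k j * (y ord0 k - y ord0 j) ^+ 2.
Proof.
pose D := \sum_k lam ord0 k * y ord0 k ^+ 2.
pose D1 := \sum_k lam ord0 k * (\sum_j Pr k j) * y ord0 k ^+ 2.
pose E := \sum_k \sum_j lam ord0 k * Pr k j * y ord0 k * y ord0 j.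
pose D2 := \sum_j (\sum_k lam ord0 k * Pr k j) * y ord0 j ^+ 2.
have -> : bilin flow_mx y y = D - E.
  rewrite flow_mxE /E exchange_big -sumrB; apply: eq_bigr => j _ /=.
  rewrite mulrBr expr2 mulrCA; congr (_ - _).
  by rewrite mulr_sumr; apply: eq_bigr => k _; ring.
have -> : \sum_j arrival_rate N ord0 j * y ord0 j ^+ 2 = D - D2.
  rewrite -sumrB; apply: eq_bigr => j _; rewrite -mulrBl; congr (_ * _).
  by rewrite -[in RHS](traffic_eq j) addrK.
have -> : \sum_k lam ord0 k * (1 - \sum_j Pr k j) * y ord0 k ^+ 2 = D - D1.
  by rewrite -sumrB; apply: eq_bigr => j _; ring.
have -> : \sum_k \sum_j lam ord0 k * Pr k j * (y ord0 k - y ord0 j) ^+ 2 =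
    D1 + D2 - 2 * E.
  have -> : D2 = \sum_k \sum_j lam ord0 k * Pr k j * y ord0 j ^+ 2.
    by rewrite exchange_big; apply: eq_bigr => j _; rewrite /= mulr_suml.
  rewrite /D1 /E mulr_sumr -big_split -sumrB; apply: eq_bigr => k _ /=.
  rewrite mulr_sumr mulr_suml mulr_sumr -big_split -sumrB.
  by apply: eq_bigr => j _ /=; ring.
by ring.
Qed.

(** If the form vanishes at [y], so do its exit and transfer terms. With positive traffic this gives
    [(1%:M - Pr) *m y^T = 0], hence [y = 0] in an open network. *)
Lemma flow_mx_gt0 (y : 'rV[R]_n) : (forall j, 0 < lam ord0 j) -> y != 0 ->
  0 < bilin flow_mx y y.
Proof.
move=> lam0 y0; rewrite -(pmulr_rgt0 _ (ltr0n _ 2)) flow_mx_dirichlet.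
have t1 j : 0 <= arrival_rate N ord0 j * y ord0 j ^+ 2.
  by rewrite mulr_ge0 ?arrival_rate_ge0 ?sqr_ge0.
have t2 k : 0 <= lam ord0 k * (1 - \sum_j Pr k j) * y ord0 k ^+ 2.
  rewrite mulr_ge0 ?sqr_ge0// mulr_ge0 ?(ltW (lam0 k))//.
  by rewrite subr_ge0 routing_mx_le1.
have t3 k j : 0 <= lam ord0 k * Pr k j * (y ord0 k - y ord0 j) ^+ 2.
  by rewrite mulr_ge0 ?sqr_ge0// mulr_ge0 ?routing_mx_ge0// ltW.
have s1 : 0 <= \sum_j arrival_rate N ord0 j * y ord0 j ^+ 2 by exact: sumr_ge0.
have s2 : 0 <= \sum_k lam ord0 k * (1 - \sum_j Pr k j) * y ord0 k ^+ 2.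
  exact: sumr_ge0.
have s3 : 0 <= \sum_k \sum_j lam ord0 k * Pr k j * (y ord0 k - y ord0 j) ^+ 2.
  by apply: sumr_ge0 => k _; exact: sumr_ge0.
rewrite lt_neqAle !addr_ge0// andbT eq_sym; apply: contra y0 => /eqP s0.
have {}s2 : \sum_k lam ord0 k * (1 - \sum_j Pr k j) * y ord0 k ^+ 2 = 0 by lra.
have {}s3 : \sum_k \sum_j lam ord0 k * Pr k j * (y ord0 k - y ord0 j) ^+ 2 = 0.
  by lra.
have {}t2 k : (1 - \sum_j Pr k j) * y ord0 k = 0.
  have /eqP := psumr_eq0P (fun k _ => t2 k) s2 (i := k) erefl.
  by rewrite -mulrA mulf_eq0 gt_eqF//= expr2 mulrA mulf_eq0 => /orP[]/eqP// ->;
    rewrite mulr0.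
have {}t3 k j : Pr k j * (y ord0 k - y ord0 j) = 0.
  have s3k : \sum_j lam ord0 k * Pr k j * (y ord0 k - y ord0 j) ^+ 2 = 0.
    by apply: (psumr_eq0P _ s3) => // i _; exact: sumr_ge0.
  have /eqP := psumr_eq0P (fun j _ => t3 k j) s3k (i := j) erefl.
  by rewrite -mulrA mulf_eq0 gt_eqF//= expr2 mulrA mulf_eq0 => /orP[]/eqP// ->;
    rewrite mulr0.
apply/eqP; apply: trmx_inj; rewrite trmx0.
rewrite -[y^T](mulKmx (routing_mx_open N)) -[RHS](mulmx0 _ (invmx (1%:M - Pr))).
congr (_ *m _); apply/colP => k; rewrite mulmxBl mul1mx !mxE.
under eq_bigr => j _ do rewrite mxE.
have -> : \sum_j Pr k j * y ord0 j = (\sum_j Pr k j) * y ord0 k.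
  rewrite mulr_suml; apply: eq_bigr => j _.
  by apply/esym/eqP; rewrite -subr_eq0 -mulrBr t3.
by rewrite -[X in X - _]mul1r -mulrBl t2.
Qed.

(** An open half-space is convex, and the hull is the smallest convex set containing [A]. *)
Lemma convex_hull_dotv_lt (A : set 'rV[R]_n) (c x : 'rV[R]_n) (m : R) :
  (forall s, A s -> dotv c s < m) -> convex_hull A x -> dotv c x < m.
Proof.
move=> Am /(_ [set z | dotv c z < m]); apply; split => //.
apply/convex_setW => u v /set_mem /= um /set_mem /= vm p p0 p1.
apply/mem_set; rewrite /= /conv /=.
have -> (a b : R) : dotv c (a *: u + b *: v) = a * dotv c u + b * dotv c v.
  rewrite !dotvE !mulr_sumr -big_split; apply: eq_bigr => j _ /=.
  by rewrite !mxE; ring.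
have -> : m = p%:num * m + (1 - p%:num) * m by ring.
by rewrite ltrD ?ltr_pM2l// subr_gt0.
Qed.

Hypothesis load_capacity : capacity_region N rho.

Lemma load_nbhs : exists2 e, 0 < e & forall x : 'rV[R]_n,
  (forall j, `|rho ord0 j - x ord0 j| < e) ->
  convex_hull [set rvec R s | s in [set` schedules N]] x.
Proof.
have /nbhs_ballP[e /= e0 he] := load_capacity.
exists e => // x xe; apply: he; split => // i j.
by rewrite (ord1 i); exact: xe.
Qed.

(** Lowering coordinate [j] of the load a little stays in the hull, where no coordinate is
    negative. *)
Lemma load_gt0 j : 0 < rho ord0 j.
Proof.
have [e e0 he] := load_nbhs.
pose x := rho - (e / 2) *: delta_mx ord0 j.
have xE k : x ord0 k = rho ord0 k - e / 2 * (k == j)%:R.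
  by rewrite /x !mxE eqxx.
have /he : forall k, `|rho ord0 k - x ord0 k| < e.
  move=> k; rewrite xE opprB addrCA subrr addr0.
  case: eqP => _; rewrite ?mulr0 ?normr0// mulr1 ger0_norm; lra.
have dotj (v : 'rV[R]_n) : dotv (- delta_mx ord0 j) v = - v ord0 j.
  rewrite dotvE (bigD1 j)//= big1 => [|k /negbTE kj]; rewrite !mxE ?eqxx ?kj.
    by rewrite addr0 mulN1r.
  by rewrite oppr0 mul0r.
move=> /(@convex_hull_dotv_lt _ (- delta_mx ord0 j) x (e / 4)).
rewrite !dotj xE eqxx => H; have {}H := H _.
suff : - (rho ord0 j - e / 2 * true%:R) < e / 4 by rewrite mulr1; lra.
apply: H => _ [s _ <-]; rewrite dotj mxE.
by have : 0 <= (s j)%:R :> R by []; lra.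
Qed.

Lemma traffic_gt0 j : 0 < lam ord0 j.
Proof.
have := load_gt0 j; rewrite mxE pmulr_lgt0// invr_gt0.
exact: completion_prob_gt0.
Qed.

Lemma capacity_slack : exists2 e, 0 < e & forall q : 'rV[R]_n,
  (forall j, 0 <= q ord0 j) -> exists2 s, s \in schedules N &
    e * \sum_j q ord0 j <= \sum_j q ord0 j * ((s j)%:R / rho ord0 j - 1).
Proof.
have [d d0 hd] := load_nbhs.
pose r := \sum_j rho ord0 j.
have r0 : 0 <= r by apply: sumr_ge0 => j _; rewrite ltW// load_gt0.
(* Then [e * rho ord0 j < d] for every [j], since no coordinate exceeds [r]. *)
pose e := d / (2 * (1 + r)).
have e0 : 0 < e by rewrite divr_gt0// mulr_gt0//; lra.
exists e => // q q0; apply: contrapT => nos.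
pose c : 'rV[R]_n := \row_j (q ord0 j / rho ord0 j).
have hx : forall j, `|rho ord0 j - ((1 + e) *: rho) ord0 j| < d.
  move=> j; have rj := load_gt0 j; have rjr : rho ord0 j <= r.
    rewrite /r (bigD1 j)//= lerDl sumr_ge0// => k _.
    by rewrite ltW// load_gt0.
  have -> : rho ord0 j - ((1 + e) *: rho) ord0 j = - (e * rho ord0 j).
    by rewrite [((1 + e) *: rho) _ _]mxE; ring.
  rewrite normrN ger0_norm; last by rewrite mulr_ge0// ltW.
  by rewrite /e mulrAC ltr_pdivrMr ?ltr_pM2l//; lra.
have := @convex_hull_dotv_lt _ c _ ((1 + e) * \sum_j q ord0 j) _ (hd _ hx).
have -> : dotv c ((1 + e) *: rho) = (1 + e) * \sum_j q ord0 j.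
  rewrite dotvE mulr_sumr; apply: eq_bigr => j _; rewrite mxE.
  rewrite [((1 + e) *: rho) _ _]mxE.
  by field; rewrite gt_eqF// load_gt0.
rewrite ltxx => H; suff: false by []; apply: H => _ [s sS <-].
rewrite ltNge; apply/negP => le_s; apply: nos; exists s => //.
under [leRHS]eq_bigr => j _ do rewrite mulrBr mulr1.
rewrite sumrB; move: le_s; rewrite dotvE.
have -> : \sum_j c ord0 j * rvec R s ord0 j =
    \sum_j q ord0 j * ((s j)%:R / rho ord0 j).
  by apply: eq_bigr => j _; rewrite !mxE; ring.
by lra.
Qed.

End NetworkAlgebra.
(** * Positive recurrence of countable chains *)

Inductive reach (St : Type) (step : St -> St -> Prop) (x : St) : St -> Prop :=
  | reach_refl : reach step x x
  | reach_step y z of step x y & reach step y z : reach step x z.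

Lemma reach_trans (St : Type) (step : St -> St -> Prop) (x y z : St) :
  reach step x y -> reach step y z -> reach step x z.
Proof. by elim=> // {x} x x' y' xx' _ IH /IH; exact: reach_step. Qed.

Lemma reach1 (St : Type) (step : St -> St -> Prop) (x y : St) :
  step x y -> reach step x y.
Proof. by move=> xy; apply: reach_step xy _; exact: reach_refl. Qed.

Lemma seq_lower_bound (R : realFieldType) (T : eqType) (s : seq T) (f : T -> R) :
  (forall x, x \in s -> 0 < f x) ->
  exists2 e, 0 < e & forall x, x \in s -> e <= f x.
Proof.
elim: s => [|a s IH] f0; first by exists 1.
have [x xs|e e0 ef] := IH; first by rewrite f0// inE xs orbT.
exists (Order.min e (f a)); first by rewrite lt_min e0 f0// mem_head.
move=> x; rewrite inE => /predU1P[->|/ef xe]; first by rewrite ge_min lexx orbT.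
by rewrite ge_min xe.
Qed.

Section Recurrence.
Context (R : realType) (St : countType) (d : measure_display)
  (T : measurableType d) (P : probability T R) (Q : St -> nat -> T -> St).
Local Open Scope ereal_scope.

Definition transition (f : St -> \bar R) (x : St) : \bar R :=
  \int[P]_w f (Q x 1%N w).

Definition avoiding (G : set St) (x : St) (t : nat) : set T :=
  [set w | forall i, (0 < i <= t)%N -> ~ G (Q x i w)].

(** Only the past events that return times involve are tested; the law of the next step is that of
    the chain started afresh at the current state. *)
Definition markovian : Prop := forall G x t (f : St -> \bar R),
  (forall y, 0 <= f y) ->
  \int[P]_(w in avoiding G x t) f (Q x t.+1 w) =
  \int[P]_(w in avoiding G x t) transition f (Q x t w).

Definition killed (G : set St) (f : St -> \bar R) (y : St) : \bar R :=
  if `[<G y>] then 0 else f y.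

(** The probability of staying out of [G] at times 1 to [t], as [survivalE] shows from the Markov
    property. The initial state is not tested. *)
Definition survival (G : set St) (t : nat) : St -> \bar R :=
  iter t (fun f => transition (killed G f)) (cst 1).

Arguments survival : simpl never.

Definition one_step (x y : St) : Prop := 0 < P [set w | Q x 1%N w = y].

Hypothesis Q0 : forall x w, Q x 0%N w = x.
Hypothesis measurable_Q : forall x t y, measurable [set w | Q x t w = y].

Lemma measurable_preimage_Q x t (A : set St) : measurable [set w | A (Q x t w)].
Proof.
have -> : [set w | A (Q x t w)] =
    \bigcup_y (if `[<A y>] then [set w | Q x t w = y] else set0).
  apply/seteqP; split => [w /= Aw|w [y _]]; first by exists (Q x t w) => //;
    rewrite asboolT.
  by case: asboolP => //= Ay ->.
apply: countable_bigcupT_measurable => // y.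
by case: asboolP => _.
Qed.

Lemma measurable_comp_Q (f : St -> \bar R) x t (D : set T) :
  measurable_fun D (fun w => f (Q x t w)).
Proof.
move=> mD B mB; apply: measurableI => //.
exact: (measurable_preimage_Q x t (f @^-1` B)).
Qed.

Lemma transition_ge0 f x : (forall y, 0 <= f y) -> 0 <= transition f x.
Proof. by move=> f0; apply: integral_ge0 => w _; exact: f0. Qed.

Lemma not_step_null (A : set St) x : (forall y, one_step x y -> A y) ->
  P [set w | ~ A (Q x 1%N w)] = 0.
Proof.
move=> xA; pose B (k : nat) := [set w | ~ A (Q x 1%N w) /\ choice.pickle (Q x 1%N w) = k].
have BE : [set w | ~ A (Q x 1%N w)] = \bigcup_k B k.
  apply/seteqP; split => [w /= Aw|w [k _ []]//].
  by exists (choice.pickle (Q x 1%N w)).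
have mA : measurable [set w | ~ A (Q x 1%N w)].
  exact: (measurable_preimage_Q x 1 (~` A)).
apply/negligibleP => //; rewrite BE.
apply: negligible_bigcup => k.
have [[y yk Ay]|no] := pselect (exists2 y : St, choice.pickle y = k & ~ A y).
  apply: (@negligibleS _ _ _ _ [set w | Q x 1%N w = y]).
    by move=> w [_] /=; rewrite -yk => /(pcan_inj choice.pickleK).
  apply/negligibleP => //; apply: contrapT => /eqP; rewrite -measure_gt0 => /xA.
  exact: Ay.
rewrite (_ : B k = set0); first exact: negligible_set0.
by apply/seteqP; split => // w [Aw wk]; apply: no; exists (Q x 1%N w).
Qed.

Lemma transition_le (A : set St) f g x : (forall y, 0 <= f y) ->
  (forall y, 0 <= g y) -> (forall y, one_step x y -> A y) ->
  (forall y, A y -> f y <= g y) -> transition f x <= transition g x.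
Proof.
move=> f0 g0 xA fg; apply: ae_ge0_le_integral => //; try exact: measurable_comp_Q.
exists [set w | ~ A (Q x 1%N w)]; split; first exact: (measurable_preimage_Q x 1 (~` A)).
  exact: not_step_null.
by move=> w /= wfg Aw; apply: wfg => _; exact: fg.
Qed.

Lemma transition_mono f g x : (forall y, 0 <= f y) ->
  (forall y, f y <= g y) -> transition f x <= transition g x.
Proof.
move=> f0 fg; apply: (@transition_le setT) => // y.
exact: le_trans (f0 y) (fg y).
Qed.

Lemma transitionD f g x : (forall y, 0 <= f y) -> (forall y, 0 <= g y) ->
  transition (fun y => f y + g y) x = transition f x + transition g x.
Proof. by move=> f0 g0; rewrite /transition ge0_integralD//; exact: measurable_comp_Q. Qed.

Lemma transitionZ (c : R) f x : (0 <= c)%R -> (forall y, 0 <= f y) ->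
  transition (fun y => c%:E * f y) x = c%:E * transition f x.
Proof.
move=> c0 f0; rewrite /transition ge0_integralZl//; exact: measurable_comp_Q.
Qed.

Lemma transition1 x : transition (cst 1) x = 1.
Proof.
by rewrite /transition integral_cst// mul1e; exact: probability_setT.
Qed.

Lemma exists_one_step x : exists y, one_step x y.
Proof.
apply: contrapT => no; have := @not_step_null set0 x.
rewrite (_ : [set _ | _] = setT); last by apply/seteqP; split => // w _ [].
rewrite (@probability_setT _ _ _ P) => P1; suff : 1 = 0 :> \bar R.
  by apply/eqP; rewrite onee_eq0.
by apply: P1 => y xy; apply: no; exists y.
Qed.

Lemma killed_ge0 G f : (forall y, 0 <= f y) -> forall y, 0 <= killed G f y.
Proof. by move=> f0 y; rewrite /killed; case: ifP. Qed.

Lemma killed_le G f : (forall y, 0 <= f y) -> forall y, killed G f y <= f y.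
Proof. by move=> f0 y; rewrite /killed; case: ifP. Qed.

Lemma survival_ge0 G t x : 0 <= survival G t x.
Proof.
elim: t x => [|t IH] x; first exact: lee01.
by apply: transition_ge0; exact: killed_ge0.
Qed.

Lemma survivalS G t x :
  survival G t.+1 x = transition (killed G (survival G t)) x.
Proof. by []. Qed.

Lemma survival_decr G t x : survival G t.+1 x <= survival G t x.
Proof.
elim: t x => [|t IH] x.
  rewrite -[leRHS](transition1 x); apply: transition_mono.
    exact/killed_ge0.
  exact/killed_le.
rewrite survivalS; apply: transition_mono.
  by apply: killed_ge0; exact: survival_ge0.
by move=> y; rewrite /killed; case: ifP.
Qed.

Lemma survival_mono G s t x : (s <= t)%N -> survival G t x <= survival G s x.
Proof.
move=> /subnK <-; elim: (t - s)%N => // k; rewrite addSn.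
exact: le_trans (survival_decr _ _ _).
Qed.

Lemma survival_le1 G t x : survival G t x <= 1.
Proof. exact: (@survival_mono G 0). Qed.

Lemma survival_fin G t x : survival G t x \is a fin_num.
Proof.
rewrite ge0_fin_numE ?survival_ge0//.
by rewrite (le_lt_trans (survival_le1 _ _ _))// ltry.
Qed.

Lemma survival_set0 t x : survival set0 t x = 1.
Proof.
elim: t x => // t IH x; rewrite survivalS -[RHS](transition1 x).
apply: eq_integral => w _; rewrite /killed IH; case: asboolP => //.
Qed.

(** Induction on [m]: the sum of [m + 1] terms is [c] plus the killed kernel applied to the sum of
    [m] terms, and the drift inequality keeps this below [U]. As [A] is closed, the induction
    hypothesis holds at the next state. *)
Lemma foster (A G : set St) (U : St -> \bar R) (c : R) :
  (forall x y, A x -> one_step x y -> A y) -> (0 <= c)%R ->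
  (forall x, 0 <= U x) ->
  (forall x, A x -> transition (killed G U) x + c%:E <= U x) ->
  forall m x, A x -> \sum_(t < m) c%:E * survival G t x <= U x.
Proof.
move=> closedA c0 U0 drift; elim=> [|m IH] x Ax; first by rewrite big_ord0.
rewrite big_ord_recl mule1 addeC; apply: le_trans (drift x Ax).
rewrite leeD2r//.
pose S y := \sum_(t < m) c%:E * survival G t y.
have S0 y : 0 <= S y.
  by apply: sume_ge0 => t _; rewrite mule_ge0 ?lee_fin ?survival_ge0.
have -> : \sum_(t < m) c%:E * survival G (lift ord0 t) x =
    transition (killed G S) x.
  under eq_bigr => t _ do rewrite lift0.
  rewrite /S; elim: m {IH S S0} => [|m IH].
    rewrite big_ord0; apply/esym/integral0_eq => w _; rewrite /killed.
    by case: ifP => //; rewrite big_ord0.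
  rewrite big_ord_recr /= {}IH survivalS -transitionZ//; last first.
    by apply: killed_ge0; exact: survival_ge0.
  rewrite -transitionD//.
  - apply: eq_integral => w _; rewrite /killed; case: ifP => _.
      by rewrite mule0 adde0.
    by rewrite big_ord_recr.
  - by apply: killed_ge0 => y; apply: sume_ge0 => t _;
      rewrite mule_ge0 ?lee_fin ?survival_ge0.
  - by move=> y; rewrite mule_ge0 ?lee_fin//; apply: killed_ge0 => z;
      exact: survival_ge0.
apply: (@transition_le A).
- exact: killed_ge0.
- exact: killed_ge0.
- by move=> y; exact: closedA.
- by move=> y Ay; rewrite /killed; case: ifP => // _; exact: IH.
Qed.

Lemma transition_lt1 f x y : (forall z, 0 <= f z <= 1) -> one_step x y ->
  f y < 1 -> transition f x < 1.
Proof.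
move=> f01 xy fy.
have f0 z : 0 <= f z by case/andP: (f01 z).
have fyfin : f y \is a fin_num by rewrite ge0_fin_numE// (lt_trans fy)// ltry.
pose a := (1 - fine (f y))%R.
have a0 : (0 < a)%R by rewrite subr_gt0 -lte_fin fineK.
(* [h] is the defect of [f] from 1, at [y] only: [f + h] is at most 1 and [h] has positive mean. *)
pose h z : \bar R := if z == y then a%:E else 0.
have h0 z : 0 <= h z by rewrite /h; case: ifP => // _; rewrite lee_fin ltW.
have hx : transition h x = a%:E * P [set w | Q x 1%N w = y].
  rewrite -integral_cst// -[X in integral _ X _]setTI integral_mkcondr.
  apply: eq_integral => w _; rewrite /h patchE; case: eqP => [Qy|Qy].
    by rewrite mem_set.
  by rewrite memNset.
have : transition f x + transition h x <= 1.
  rewrite -transitionD// -[leRHS](transition1 x); apply: transition_mono.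
    by move=> z; exact: adde_ge0.
  move=> z; rewrite /h; case: eqP => [->|_]; last first.
    by rewrite adde0; case/andP: (f01 z).
  by rewrite -(fineK fyfin) -EFinD lee_fin /a addrC subrK.
have hx0 : 0 < transition h x by rewrite hx mule_gt0.
have : transition f x <= 1.
  rewrite -[leRHS](transition1 x); apply: transition_mono => // z.
  by case/andP: (f01 z).
rewrite le_eqVlt => /predU1P[->|//].
by rewrite leNgt lteDl// hx0.
Qed.

(** A path of positive probability into [G] brings the survival below 1. A first step is required
    because [survival] does not test the initial state. *)
Lemma reach_survival G x x' y : one_step x x' -> reach one_step x' y -> G y ->
  exists t, survival G t x < 1.
Proof.
move=> + x'y Gy; elim: x'y Gy x => {x' y} [x'|x' x'' y x'x'' _ IH] Gy x xx'.
  exists 1%N; apply: transition_lt1 xx' _ => [z|]; rewrite /killed /=.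
    by case: ifP => _; rewrite lexx lee01.
  by rewrite asboolT.
have [t tx'] := IH Gy _ x'x''; exists t.+1.
apply: transition_lt1 xx' _ => [z|]; rewrite /killed; case: ifP => //.
  by rewrite lexx lee01.
by rewrite survival_ge0 survival_le1.
Qed.

(** * Negative drift outside a finite set *)

Section FiniteTarget.
Variables (W : St -> R) (C : set St) (s : seq St) (c b0 : R).
Hypotheses (W0 : forall x, (0 <= W x)%R) (c0 : (0 < c)%R) (b00 : (0 <= b0)%R).
Hypothesis CE : forall x, C x <-> x \in s.
Hypothesis drift : forall x, ~ C x ->
  transition (EFin \o W) x + c%:E <= (W x)%:E.
Hypothesis growth : forall x, transition (EFin \o W) x <= (W x + b0)%:E.

(* Adding to [W] a multiple of the mean time to [G] truncated at [t0]
   makes the drift negative on [C] too. *)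
Lemma survival_summable (A G : set St) :
  (forall x y, A x -> one_step x y -> A y) ->
  (forall x, A x -> exists t, survival G t x < 1) ->
  forall x, A x -> \sum_(t <oo) survival G t x < +oo.
Proof.
move=> closedA hit.
have [t0 ht0] : exists t0, forall x, x \in s -> A x -> survival G t0 x < 1.
  elim: s => [|a s' [t0 IH]]; first by exists 0%N.
  have [Aa|nAa] := pselect (A a); last first.
    exists t0 => x; rewrite inE => /predU1P[-> //|]; exact: IH.
  have [t1 ht1] := hit a Aa; exists (maxn t0 t1) => x.
  rewrite inE => /predU1P[-> _|xs Ax].
    by apply: le_lt_trans ht1; apply: survival_mono; exact: leq_maxr.
  by apply: le_lt_trans (IH x xs Ax); apply: survival_mono; exact: leq_maxl.
pose v t x := fine (survival G t x).
have vE t x : survival G t x = (v t x)%:E by rewrite fineK// survival_fin.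
have [e e0 ev] : exists2 e, (0 < e)%R & forall x, x \in s -> A x ->
    (v t0 x + e <= 1)%R.
  have [x xs|e e0 ee] := @seq_lower_bound R St s
      (fun x => if `[<A x>] then (1 - v t0 x)%R else 1%R).
    case: asboolP => [Ax|_]; last exact: ltr01.
    by rewrite subr_gt0 -lte_fin -vE ht0.
  exists e => // x xs Ax; have := ee x xs.
  by rewrite asboolT// lerBrDl.
(* On [C] the gain [b * e] pays for the growth [b0] and leaves the drift [c]. *)
pose b := ((b0 + c) / e)%R.
have b0' : (0 <= b)%R by rewrite divr_ge0 ?(ltW e0)// addr_ge0// ltW.
pose psi x := (\sum_(t < t0) v t x)%R.
have psi0 x : (0 <= psi x)%R.
  by apply: sumr_ge0 => t _; rewrite -lee_fin -vE survival_ge0.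
(* The killed kernel shifts the sum by one index: the term [v 0 x], equal to 1, is lost and [v t0 x]
   is gained. *)
have psiK x : transition (killed G (EFin \o psi)) x =
    (psi x + v t0 x - 1)%:E.
  rewrite /psi; elim: t0 {ht0 ev psi psi0} => [|t IH].
    rewrite big_ord0 add0r /v /= subrr; apply: integral0_eq => w _.
    by rewrite /killed /=; case: ifP => //; rewrite big_ord0.
  have -> : transition (killed G (EFin \o fun y => \sum_(i < t.+1) v i y)%R) x =
      transition (killed G (EFin \o fun y => \sum_(i < t) v i y)%R) x +
      transition (killed G (survival G t)) x.
    rewrite -transitionD.
    - apply: eq_integral => w _; rewrite /killed; case: ifP => _.
        by rewrite adde0.
      by rewrite /= big_ord_recr /= vE.
    - apply: killed_ge0 => y; rewrite lee_fin; apply: sumr_ge0 => i _.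
      by rewrite -lee_fin -vE survival_ge0.
    - by apply: killed_ge0; exact: survival_ge0.
  rewrite IH -survivalS vE -EFinD big_ord_recr /=; congr EFin; ring.
pose U x := (W x + b * psi x)%R%:E.
have U0 x : 0 <= U x by rewrite lee_fin addr_ge0// mulr_ge0.
have UK x : transition (killed G U) x <=
    transition (EFin \o W) x + (b * (psi x + v t0 x - 1))%:E.
  rewrite EFinM -psiK -transitionZ//; last exact/killed_ge0.
  rewrite -transitionD//.
  - apply: transition_mono => [|y]; first exact: killed_ge0.
    rewrite /killed; case: ifP => _.
      by rewrite mule0 adde0 /= lee_fin.
    by rewrite /U /= EFinD EFinM.
  - by move=> y; rewrite mule_ge0 ?lee_fin//; apply: killed_ge0 => z; rewrite /= lee_fin.
have Udrift x : A x -> transition (killed G U) x + c%:E <= U x.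
  move=> Ax; apply: (le_trans (leeD2r _ (UK x))).
  have v1 : (v t0 x <= 1)%R by rewrite -lee_fin -vE survival_le1.
  have [Cx|nCx] := pselect (C x).
    apply: (@le_trans _ _ ((W x + b0)%:E + (b * (psi x + v t0 x - 1))%:E + c%:E)).
      by rewrite !leeD2r.
    rewrite -!EFinD lee_fin.
    have : (b * (v t0 x + e) <= b * 1)%R by rewrite ler_wpM2l// ev// -CE.
    have : (b * e = b0 + c)%R by rewrite /b divfK// gt_eqF.
    by lra.
  rewrite addeAC; apply: (@le_trans _ _ ((W x)%:E + (b * (psi x + v t0 x - 1))%:E)).
    by rewrite leeD2r// drift.
  rewrite -EFinD lee_fin lerD2l ler_wpM2l//; lra.
move=> x Ax.
have bound m : \sum_(t < m) survival G t x <= (c^-1)%:E * U x.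
  rewrite -[leLHS]mul1e -[X in X%:E * _](mulVf (lt0r_neq0 c0)) EFinM -muleA.
  rewrite lee_pmul2l ?lte_fin ?invr_gt0//.
  rewrite ge0_sume_distrr//; last by move=> *; exact: survival_ge0.
  exact: (foster closedA (ltW c0) U0 Udrift).
apply: (@le_lt_trans _ _ ((c^-1)%:E * U x)); last by rewrite -EFinM ltry.
apply: lime_le; first by apply: is_cvg_nneseries => *; exact: survival_ge0.
by apply: nearW => m; rewrite big_mkord; exact: bound.
Qed.

(** Otherwise the drift inequality holds at every state reachable from [x]. Foster's bound with the
    empty target, where survival is always 1, then bounds all multiples of [c] by [W x]. *)
Lemma reach_finite x : exists2 y, C y & reach one_step x y.
Proof.
apply: contrapT => no; pose A := [set y | reach one_step x y].
have closedA y z : A y -> one_step y z -> A z.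
  by move=> xy /(@reach1 _ one_step); exact: reach_trans.
have Adrift y : A y -> transition (killed set0 (EFin \o W)) y + c%:E <= (W y)%:E.
  move=> Ay; apply: le_trans (drift _); last by move=> Cy; apply: no; exists y.
  rewrite leeD2r//; apply: transition_mono => [|z].
    by apply: killed_ge0 => z; rewrite /= lee_fin.
  by apply: killed_le => {}z; rewrite /= lee_fin.
have W0' y : 0 <= (EFin \o W) y by rewrite lee_fin.
have H := foster closedA (ltW c0) W0' Adrift.
have := H (Num.truncn (W x / c)).+1 x (reach_refl _ _).
under eq_bigr => t _ do rewrite survival_set0 mule1.
rewrite sumEFin lee_fin sumr_const card_ord -[leLHS]mulr_natl.
rewrite -ler_pdivlMr// leNgt.
by rewrite truncnS_gt.
Qed.

(** Induction on the number of elements of [C] reachable from [x]: a reachable [z] that does not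
    lead back to [x] has fewer, since it misses [x] itself. *)
Lemma reach_maximal x : C x -> exists y, [/\ C y, reach one_step x y &
  forall z, C z -> reach one_step y z -> reach one_step z y].
Proof.
pose k y := count (fun z => `[<reach one_step y z>]) s.
have [m] := ubnP (k x); elim: m x => // m IH x; rewrite ltnS => kx Cx.
have [[z [Cz xz zx]]|no] := pselect (exists z,
    [/\ C z, reach one_step x z & ~ reach one_step z x]); last first.
  exists x; split => //; first exact: reach_refl.
  by move=> z Cz xz; apply: contrapT => zx; apply: no; exists z.
have [|//|y [Cy zy ymax]] := IH z; last first.
  by exists y; split => //; exact: reach_trans zy.
apply: leq_trans kx; pose a := fun u => `[<reach one_step z u>].
have kz : (0 < count_mem x s)%N by rewrite -has_count has_pred1; exact/CE.
apply: (@leq_trans (count a s + count_mem x s)); first by rewrite -addn1 leq_add2l.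
rewrite -count_predUI (@eq_count _ (predI a (pred1 x)) pred0).
  rewrite count_pred0 addn0; apply: sub_count => u /= /orP[/asboolP zu|/eqP ->].
    by apply/asboolP; exact: reach_trans zu.
  by apply/asboolP; exact: reach_refl.
by move=> u /=; apply/negP => /andP[/asboolP zu /eqP ux]; apply: zx; rewrite -ux.
Qed.

End FiniteTarget.

Hypothesis Qmarkov : markovian.

Lemma avoidingS G x t :
  avoiding G x t.+1 = avoiding G x t `&` [set w | ~ G (Q x t.+1 w)].
Proof.
apply/seteqP; split => [w h|w [h ht] i /andP[i0]].
  split => [i /andP[i0 it]|]; last by apply: h; rewrite ltnSn.
  by apply: h; rewrite i0 leqW.
rewrite leq_eqVlt => /predU1P[->//|it].
by apply: h; rewrite i0.
Qed.

Lemma measurable_avoiding G x t : measurable (avoiding G x t).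
Proof.
elim: t => [|t IH].
  rewrite (_ : avoiding G x 0 = setT)//; apply/seteqP; split => // w _ i.
  by rewrite leqn0 => /andP[i0 /eqP i00]; rewrite i00 in i0.
rewrite avoidingS; apply: measurableI => //.
exact: (measurable_preimage_Q x t.+1 (~` G)).
Qed.

(** Induction on [t] for all [f] at once: the Markov property replaces the last step by the kernel
    applied to [killed G f]. *)
Lemma integral_avoiding G x t (f : St -> \bar R) : (forall y, 0 <= f y) ->
  \int[P]_(w in avoiding G x t) f (Q x t w) =
  iter t (fun f => transition (killed G f)) f x.
Proof.
elim: t f => [|t IH] f f0.
  rewrite (_ : avoiding G x 0 = setT); last first.
    apply/seteqP; split => // w _ i.
    by rewrite leqn0 => /andP[i0 /eqP i00]; rewrite i00 in i0.
  under eq_integral => w _ do rewrite Q0.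
  rewrite integral_cst// -[RHS]mule1; congr (_ * _).
  exact: probability_setT.
rewrite iterSr -IH; last by move=> y; apply: transition_ge0; exact: killed_ge0.
rewrite -Qmarkov; last exact: killed_ge0.
rewrite avoidingS integral_mkcondr; apply: eq_integral => w _.
rewrite patchE /killed; case: asboolP => [Gw|nGw].
  by rewrite memNset.
by rewrite mem_set.
Qed.

Lemma survivalE G x t : P (avoiding G x t) = survival G t x.
Proof.
rewrite /survival -integral_avoiding//.
by rewrite integral_cst ?mul1e//; exact: measurable_avoiding.
Qed.

(** The tail sum formula, path by path: [avoiding G x t] is the event that the return time exceeds
    [t]. *)
Lemma return_timeE G x w : return_time R Q G x w =
  \sum_(t <oo) (\1_(avoiding G x t) w)%:E.
Proof.
have ind1 t : (forall i, (0 < i <= t)%N -> ~ G (Q x i w)) ->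
    (\1_(avoiding G x t) w)%:E = 1 :> \bar R.
  by move=> h; rewrite indicE mem_set.
have [hk|no] := pselect (exists k, (0 < k)%N && `[<G (Q x k w)>]); last first.
  have noG i : (0 < i)%N -> ~ G (Q x i w).
    by move=> i0 Gi; apply: no; exists i; rewrite i0 asboolT.
  rewrite /return_time (_ : [set _ | _ in _] = set0); last first.
    by apply/seteqP; split => // y [t [t0 Gt] yt]; exact: (noG t).
  rewrite ereal_inf0; apply/esym/eqyP => A A0.
  apply: le_trans (nneseries_lim_ge (Num.truncn A).+1 _); last first.
    by move=> t _ _; rewrite lee_fin.
  rewrite (eq_bigr (fun=> 1)); last by move=> t _; rewrite ind1// => i /andP[/noG].
  rewrite sumEFin big_const_nat subn0 iter_addr addr0 lee_fin ltW//.
  by rewrite truncnS_gt.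
have [k /andP[kgt0 /asboolP Gk] kmin] := ex_minnP hk.
have -> : return_time R Q G x w = k%:R%:E.
  apply/eqP; rewrite eq_le; apply/andP; split.
    by apply: ereal_inf_lbound; exists k.
  apply: le_ereal_inf_tmp => _ [t [t0 Gt] <-]; rewrite lee_fin ler_nat.
  by apply: kmin; rewrite t0 asboolT.
rewrite (nneseries_split 0 k); last by move=> t _; rewrite lee_fin.
rewrite add0n eseries0 ?adde0; last first.
  move=> t kt _; rewrite indicE memNset// => /(_ k); apply => //.
  by rewrite kgt0 kt.
rewrite big_nat (eq_bigr (fun=> 1)); last first.
  move=> t /andP[_ tk]; rewrite ind1// => i /andP[i0 it] Gi.
  have : (k <= i)%N by apply: kmin; rewrite i0 asboolT.
  by rewrite leqNgt (leq_ltn_trans it tk).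
by rewrite -big_nat sumEFin big_const_nat subn0 iter_addr addr0.
Qed.

Theorem foster_positive_recurrent (W : St -> R) (C : set St) (c b0 : R) :
  (forall x, 0 <= W x)%R -> (0 < c)%R -> (0 <= b0)%R -> finite_set C ->
  (forall x, ~ C x -> transition (EFin \o W) x + c%:E <= (W x)%:E) ->
  (forall x, transition (EFin \o W) x <= (W x + b0)%:E) ->
  positive_recurrent P Q.
Proof.
move=> W0 c0 b00 finC drift growth.
have [s CE] : exists s : seq St, forall x, C x <-> x \in s.
  by have /finite_seqP[s ->] := finC; exists s.
(* Used with the states reachable from [y] as [A] and target [y], then with all states as [A] and
   target [F]. *)
have mean_lty (A G : set St) : (forall x y, A x -> one_step x y -> A y) ->
    (forall x, A x -> exists2 y, reach one_step x y & G y) ->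
    forall x, A x -> mean_return_time P Q G x < +oo.
  move=> closedA hit x Ax; rewrite /mean_return_time.
  under eq_integral => w _ do rewrite return_timeE.
  rewrite integral_nneseries//; last first.
    move=> t; apply/measurable_EFinP/measurable_indic.
    exact: measurable_avoiding.
  rewrite (eq_eseriesr (g := fun t => survival G t x)); last first.
    move=> t _; rewrite integral_indic//; last exact: measurable_avoiding.
    by rewrite setIT; exact: survivalE.

  apply: (survival_summable W0 c0 b00 CE drift growth closedA) Ax => y Ay.
  have [y' yy'] := exists_one_step y.
  have [z y'z Gz] := hit y' (closedA _ _ Ay yy').
  exact: reach_survival yy' y'z Gz.
pose F := [set y | C y /\ forall z, C z -> reach one_step y z -> reach one_step z y].
have toC x := reach_finite W0 c0 drift x.
exists F; split.
- by apply: sub_finite_set finC => y [].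
- move=> y [Cy ymax]; apply: (mean_lty [set z | reach one_step y z]).
  + by move=> x z yx /(@reach1 _ one_step); exact: reach_trans.
  (* A state reachable from [y] leads on to [C], and maximality leads back from there to [y]. *)
  + move=> x yx; exists y => //; have [z Cz xz] := toC x.
    by apply: reach_trans (xz) _; apply: ymax => //; exact: reach_trans xz.
  + exact: reach_refl.
- move=> x; apply: (mean_lty setT) => // z _.
  have [y Cy zy] := toC z.
  have [u [Cu yu umax]] := reach_maximal CE Cy.
  by exists u => //; exact: reach_trans yu.
Qed.

End Recurrence.
(** * Independence *)

HB.instance Definition _ (n : nat) := gen_eqMixin (primitive_index n).

Section Independence.
Context (R : realType) (d : measure_display) (T : measurableType d)
  (P : probability T R) (I : eqType) (G : I -> set_system T).
Hypothesis indepG : mutually_independent P G.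
Hypothesis salgG : forall i, sigma_algebra setT (G i).
Local Open Scope ereal_scope.

Definition generated (J : set I) : set_system T := <<s \bigcup_(i in J) G i >>.

Let cylinder (J : set I) : set_system T := [set A | exists (s : seq I) E,
  [/\ forall i, i \in s -> J i, forall i, G i (E i) &
      A = \bigcap_(i in [set` s]) E i]].

Let GT i : G i setT.
Proof. by rewrite -setC0 -setTD; case: (salgG i) => G0 + _; exact. Qed.

Let GI i A B : G i A -> G i B -> G i (A `&` B).
Proof.
have [_ _ _ + GA GB] := (sigma_algebraP (fun X _ => @subsetT _ X)).1 (salgG i).
exact.
Qed.

Lemma indep_fintype (K : finType) (i : K -> I) (E : K -> set T) :
  injective i -> (forall k, G (i k) (E k)) ->
  P (\bigcap_k E k) = \prod_k P (E k).
Proof.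
move=> inji GE; pose e (k : 'I_#|K|) : K := enum_val k.
have := indepG.2 #|K| (i \o e) (E \o e) _ _.
rewrite (reindex e) /=; last first.
  by exists enum_rank => k _; rewrite /e ?enum_valK ?enum_rankK.
move=> <-.
- congr (P _); apply/seteqP; split => [w Ew k _|w Ew k _]; first exact: Ew.
  by rewrite -(enum_rankK k); exact: Ew.
- by move=> k k' /inji /enum_val_inj.
- by move=> k; exact: GE.
Qed.

Let indep_seq (s : seq I) (E : I -> set T) : uniq s ->
  (forall i, G i (E i)) ->
  P (\bigcap_(i in [set` s]) E i) = \prod_(i <- s) P (E i).
Proof.
move=> us GE; have := @indep_fintype 'I_(size s) (tnth (in_tuple s))
  (fun k => E (tnth (in_tuple s) k)).
rewrite -(big_tnth _ _ s xpredT (fun i => P (E i))) => <- //.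
- congr (P _); apply/seteqP; split => [w Ew k _|w Ew i /= si].
    by apply: Ew; rewrite /= mem_tnth.
  by have /seq_tnthP[k ->] := si; exact: Ew.
- exact/tuple_uniqP.
Qed.

Let cylinder_indep (J1 J2 : set I) A B : J1 `&` J2 = set0 ->
  cylinder J1 A -> cylinder J2 B -> P (A `&` B) = P A * P B.
Proof.
move=> J120 [s1 [E1 [J1s GE1 ->]]] [s2 [E2 [J2s GE2 ->]]].
have disj i : i \in s1 -> i \in s2 -> False.
  by move=> /J1s J1i /J2s J2i; have : set0 i by rewrite -J120.
(* The index lists are disjoint, so that both cylinders come from one family and the product formula
   applies to the concatenated list. *)
pose E i := if i \in s1 then E1 i else E2 i.
have GE i : G i (E i) by rewrite /E; case: ifP.
have A_E : \bigcap_(i in [set` undup s1]) E i = \bigcap_(i in [set` s1]) E1 i.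
  apply/seteqP; split => w h i /= si.
    by have := h i; rewrite /= mem_undup /E si; exact.
  by move: si; rewrite mem_undup /E => si; rewrite si; exact: h.
have B_E : \bigcap_(i in [set` undup s2]) E i = \bigcap_(i in [set` s2]) E2 i.
  apply/seteqP; split => w h i /= si.
    have := h i; rewrite /= mem_undup /E si => /(_ isT).
    by case: ifP => // s1i; case: (disj i).
  move: si; rewrite mem_undup /E => si; case: ifP => [/disj/(_ si)//|_].
  exact: h.
rewrite -A_E -B_E !indep_seq ?undup_uniq// -big_cat -indep_seq//=.
  congr (P _); apply/seteqP; split => [w [h1 h2] i /=|w h].
    by rewrite mem_cat => /orP[]; [exact: h1|exact: h2].
  by split => i /= si; apply: h; rewrite /= mem_cat si ?orbT.
rewrite cat_uniq !undup_uniq/= andbT -all_predC; apply/allP => i.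
by rewrite mem_undup /= => s2i; apply/negP; rewrite mem_undup => /disj; exact.
Qed.

Let cylinder_setI J : setI_closed (cylinder J).
Proof.
move=> A B [s1 [E1 [J1s GE1 ->]]] [s2 [E2 [J2s GE2 ->]]].
exists (s1 ++ s2), (fun i => (if i \in s1 then E1 i else setT) `&`
  (if i \in s2 then E2 i else setT)); split.
- by move=> i; rewrite mem_cat => /orP[/J1s|/J2s].
- by move=> i; apply: GI; case: ifP.
- apply/seteqP; split => [w [h1 h2] i _ /=|w h].
    by split; case: ifP => // si; [exact: h1 | exact: h2].
  split => i /= si; have := h i; rewrite /= mem_cat si ?orbT => /(_ isT)[] //.
Qed.

Let generated_cylinder J A : generated J A -> <<s cylinder J >> A.
Proof.
move: A; apply: smallest_sub; first exact: smallest_sigma_algebra.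
move=> A [i Ji GA]; apply: sub_sigma_algebra.
exists [:: i], (fun j => if j == i then A else setT); split.
- by move=> j; rewrite inE => /eqP ->.
- by move=> j; case: eqP => [->|].
- apply/seteqP; split => [w Aw j /=|w /(_ i)].
  + by rewrite inE => /eqP ->; rewrite eqxx.
  + by rewrite /= inE eqxx; exact.
Qed.

Lemma generated_salg J : sigma_algebra setT (generated J).
Proof. exact: smallest_sigma_algebra. Qed.

Lemma generated_sub J i A : J i -> G i A -> generated J A.
Proof. by move=> Ji GA; apply: sub_sigma_algebra; exists i. Qed.

Lemma generated_mono J1 J2 : J1 `<=` J2 -> generated J1 `<=` generated J2.
Proof.
move=> J12; apply: smallest_sub; first exact: smallest_sigma_algebra.
by move=> A [i /J12 Ji GA]; apply: sub_sigma_algebra; exists i.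
Qed.

Lemma generated_measurable J : generated J `<=` measurable.
Proof.
apply: smallest_sub; first exact: sigma_algebra_measurable.
by move=> A [i _ GA]; exact: (proj1 indepG i).
Qed.

Let indep_dynkin (B : set T) : measurable B ->
  dynkin [set A | measurable A /\ P (A `&` B) = P A * P B].
Proof.
move=> mB; split.
- split => //; rewrite setTI -[LHS]mul1e; congr (_ * _).
  by apply/esym; exact: probability_setT.
- move=> A [mA PAB]; split; first exact: measurableC.
  have PBfin : P B \is a fin_num by exact: fin_num_measure.
  have PAfin : P A \is a fin_num by exact: fin_num_measure.
  rewrite probability_setC// muleBl// mul1e -PAB setIC -setDE.
  by rewrite measureD// 1?setIC// ltey_eq PBfin.
- move=> F tF Fi; have mF i : measurable (F i) by case: (Fi i).
  split; first exact: bigcup_measurable.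
  rewrite setI_bigcupl measure_bigcup//; last 2 first.
  + by move=> i _; exact: measurableI.
  + by apply: trivIset_setIr.
  have PBfin : P B \is a fin_num by exact: fin_num_measure.
  rewrite measure_bigcup// muleC -(fineK PBfin) -nneseriesZl//.
  apply: eq_eseriesr => i _; rewrite fineK// muleC.
  by case: (Fi i).
Qed.

(** Dynkin's theorem twice: cylinders are closed under intersection, so independence extends from
    cylinders over [J2] to [generated J2] with a cylinder over [J1] fixed, and then to
    [generated J1]. *)
Lemma generated_indep (J1 J2 : set I) A B : J1 `&` J2 = set0 ->
  generated J1 A -> generated J2 B -> P (A `&` B) = P A * P B.
Proof.
move=> J120 gA gB.
have cylm J C : cylinder J C -> measurable C.
  move=> [s [E [_ GE ->]]]; apply: fin_bigcap_measurable => //.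
  by move=> i _; exact: (proj1 indepG _ _ (GE i)).
have dyn J : <<s cylinder J >> = <<d cylinder J >>.
  by rewrite setI_closed_g_dynkin_g_sigma_algebra.
have step C : cylinder J1 C -> P (C `&` B) = P C * P B.
  move=> cC; have mC := cylm _ _ cC.
  have : <<d cylinder J2 >> `<=` [set A | measurable A /\ P (A `&` C) = P A * P C].
    apply: smallest_sub; first exact: indep_dynkin.
    move=> D cD; split; first exact: cylm cD.
    by rewrite setIC (cylinder_indep J120)// muleC.
  by rewrite -dyn => /(_ _ (generated_cylinder gB))[_]; rewrite setIC muleC.
have : <<d cylinder J1 >> `<=` [set A | measurable A /\ P (A `&` B) = P A * P B].
  apply: smallest_sub; first exact: indep_dynkin (generated_measurable gB).
  by move=> C cC; split; [exact: cylm cC | exact: step].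
by rewrite -dyn => /(_ _ (generated_cylinder gA))[].
Qed.

End Independence.

(* For countable [I], measurability of [h] with respect to [M] and the
   discrete sigma-algebra. *)
Definition discrete_rv (T : Type) (M : set_system T) (I : Type)
  (h : T -> I) := forall k, M [set w | h w = k].

Section DiscreteMeasurable.
Context (T : Type) (M : set_system T).
Hypothesis salgM : sigma_algebra setT M.

Lemma discrete_preimage (I : countType) (h : T -> I) (B : set I) :
  discrete_rv M h -> M [set w | B (h w)].
Proof.
move=> mh; have [M0 _ MU] := salgM.
pose F (k : nat) := if choice.unpickle k is Some i then
  (if `[<B i>] then [set w | h w = i] else set0) else set0.
have -> : [set w | B (h w)] = \bigcup_k F k.
  apply/seteqP; split => [w /= Bh|w [k _]].
    by exists (choice.pickle (h w)) => //; rewrite /F choice.pickleK asboolT.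
  by rewrite /F; case: choice.unpickle => //= i; case: asboolP => //= Bi ->.
apply: MU => k; rewrite /F; case: choice.unpickle => // i.
by case: asboolP.
Qed.

Lemma discrete_comp (I : countType) (I' : Type) (h : T -> I) (f : I -> I') :
  discrete_rv M h -> discrete_rv M (f \o h).
Proof. by move=> mh k; exact: (discrete_preimage (fun i => f i = k) mh). Qed.

Lemma discrete_setI A B : M A -> M B -> M (A `&` B).
Proof.
move=> MA MB.
by have [_ _ _] := (sigma_algebraP (fun X _ => @subsetT _ X)).1 salgM; exact.
Qed.

Lemma discrete_pair (I I' : Type) (h : T -> I) (h' : T -> I') :
  discrete_rv M h -> discrete_rv M h' ->
  discrete_rv M (fun w => (h w, h' w)).
Proof.
move=> mh mh' [i i'].
rewrite (_ : [set _ | _] = [set w | h w = i] `&` [set w | h' w = i']).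
  exact: discrete_setI.
by apply/seteqP; split => [w /= [-> ->]|w /= [-> ->]].
Qed.

Lemma discrete_ffun (K : finType) (I : Type) (h : K -> T -> I) :
  (forall k, discrete_rv M (h k)) ->
  discrete_rv M (fun w => [ffun k => h k w]).
Proof.
move=> mh f.
have -> : [set w | [ffun k => h k w] = f] =
    \bigcap_(k in [set` enum K]) [set w | h k w = f k].
  apply/seteqP; split => [w <- k _ /=|w hf]; first by rewrite ffunE.
  by apply/ffunP => k; rewrite ffunE; apply: hf; rewrite /= mem_enum.
elim: (enum K) => [|k s IH].
  rewrite (_ : \bigcap_(_ in _) _ = setT); last by apply/seteqP; split => // w _ k.
  by have [] := (sigma_algebraP (fun X _ => @subsetT _ X)).1 salgM.
rewrite (_ : \bigcap_(_ in _) _ = [set w | h k w = f k] `&`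
    \bigcap_(k in [set` s]) [set w | h k w = f k]).
  by apply: discrete_setI => //; exact: mh.
apply/seteqP; split => [w hf|w [h1 h2] j /=].
  split; first by apply: hf; rewrite /= mem_head.
  by move=> j /= js; apply: hf; rewrite /= inE js orbT.
by rewrite inE => /predU1P[->//|]; exact: h2.
Qed.

End DiscreteMeasurable.

(** * Integrals of functions of discrete random variables *)

Section DiscreteIntegral.
Context (R : realType) (d : measure_display) (T : measurableType d)
  (P : probability T R).
Local Open Scope ereal_scope.

Lemma discrete_measurable_fun (I : countType) (h : T -> I) (f : I -> \bar R)
    (D : set T) :
  discrete_rv measurable h -> measurable_fun D (fun w => f (h w)).
Proof.
move=> mh mD B mB; apply: measurableI => //.
exact: (discrete_preimage (@sigma_algebra_measurable _ T) (f @^-1` B) mh).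
Qed.

(** Values are enumerated by their codes. Since [unpickle] may send other numbers to [i] too, the
    condition [pickle i = k] retains only one of them. *)
Lemma integral_partition (I : countType) (h : T -> I) (g : T -> \bar R)
    (E : set T) : discrete_rv measurable h -> measurable E ->
  measurable_fun E g -> (forall w, 0 <= g w) ->
  \int[P]_(w in E) g w =
  \sum_(k <oo) (if choice.unpickle k is Some i then
    \int[P]_(w in E `&` [set w | h w = i /\ choice.pickle i = k]) g w else 0).
Proof.
move=> mh mE mg g0.
pose F (k : nat) := E `&` [set w | choice.pickle (h w) = k].
have EF : E = \bigcup_k F k.
  apply/seteqP; split => [w Ew|w [k _ []//]].
  by exists (choice.pickle (h w)).
have mF k : measurable (F k).
  apply: measurableI => //.
  exact: (discrete_preimage (@sigma_algebra_measurable _ T)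
    (fun i => choice.pickle i = k) mh).
rewrite [in LHS]EF ge0_integral_bigcup//; last 2 first.
- by rewrite -EF.
- by move=> i j _ _ [w [[_ <-] [_ <-]]].
apply: eq_eseriesr => k _.
case E1 : (choice.unpickle k) => [i|]; last first.
  rewrite (_ : F k = set0) ?integral_set0//; apply/seteqP; split => // w [_ /=].
  by move=> hk; move: E1; rewrite -hk choice.pickleK.
congr (integral _ _ _); apply/seteqP; split => [w [Ew /= hk]|w [Ew [<- hk]]].
  by split => //=; move: E1; rewrite -hk choice.pickleK => -[<-].
by split.
Qed.

(** With [c] the probability of [E], the last hypothesis says that the law of [h] given [E] is the
    law of [h']. *)
Lemma integral_discrete_scale (I : countType) (h h' : T -> I)
    (f : I -> \bar R) (E : set T) (c : R) :
  discrete_rv measurable h -> discrete_rv measurable h' ->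
  measurable E -> (forall i, 0 <= f i) ->
  (forall i, P (E `&` [set w | h w = i]) = c%:E * P [set w | h' w = i]) ->
  \int[P]_(w in E) f (h w) = c%:E * \int[P]_w f (h' w).
Proof.
move=> mh mh' mE f0 Ph.
rewrite (integral_partition mh)//; last exact: discrete_measurable_fun.
rewrite [in RHS](integral_partition mh')//; last exact: discrete_measurable_fun.
rewrite -nneseriesZl//; last first.
  move=> k _; case: choice.unpickle => // i; exact: integral_ge0.
apply: eq_eseriesr => k _; case: choice.unpickle => [i|]; last by rewrite mule0.
have [ik|nik] := eqVneq (choice.pickle i) k; last first.
  rewrite (_ : E `&` _ = set0) 1?(_ : setT `&` _ = set0) ?integral_set0 ?mule0//.
    by apply/seteqP; split => // w [_ [_ /eqP]]; rewrite (negbTE nik).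
  by apply/seteqP; split => // w [_ [_ /eqP]]; rewrite (negbTE nik).
have cst_int (D : set T) (g : T -> I) : measurable D ->
    discrete_rv measurable g ->
    \int[P]_(w in D `&` [set w | g w = i /\ choice.pickle i = k]) f (g w) =
    f i * P (D `&` [set w | g w = i]).
  move=> mD mg; rewrite (_ : [set w | g w = i /\ _] = [set w | g w = i]).
    rewrite -integral_cst; last exact: measurableI.
    by apply: eq_integral => w /set_mem[_ /= ->].
  by apply/seteqP; split => [w []|w /=].
by rewrite !cst_int// setTI Ph muleCA.
Qed.

Lemma integral_law_eq (I : countType) (h h' : T -> I) (f : I -> \bar R) :
  discrete_rv measurable h -> discrete_rv measurable h' ->
  (forall i, 0 <= f i) ->
  (forall i, P [set w | h w = i] = P [set w | h' w = i]) ->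
  \int[P]_w f (h w) = \int[P]_w f (h' w).
Proof.
move=> mh mh' f0 Ph; rewrite -[RHS]mul1e.
by apply: integral_discrete_scale => // i; rewrite setTI mul1e.
Qed.

Lemma law_preimage (I : countType) (h h' : T -> I) (B : set I) :
  discrete_rv measurable h -> discrete_rv measurable h' ->
  (forall i, P [set w | h w = i] = P [set w | h' w = i]) ->
  P [set w | B (h w)] = P [set w | B (h' w)].
Proof.
move=> mh mh' Ph.
have PE g : discrete_rv measurable g ->
    P [set w | B (g w)] = \int[P]_w (\1_B (g w))%:E.
  move=> mg; have mB : measurable [set w | B (g w)].
    exact: (discrete_preimage (@sigma_algebra_measurable _ T) B mg).
  by rewrite -[X in P X]setIT -integral_indic.
by rewrite !PE//; exact: (integral_law_eq (f := fun i => (\1_B i)%:E)).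
Qed.

End DiscreteIntegral.
(** * The Markov property *)

Section DiscreteSums.
Context (T : Type) (M : set_system T).
Hypothesis salgM : sigma_algebra setT M.

Lemma discrete_sum (K : finType) (h : K -> T -> nat) :
  (forall k, discrete_rv M (h k)) ->
  discrete_rv M (fun w => \sum_k h k w)%N.
Proof.
move=> mh; have /(discrete_comp salgM (fun f : {ffun K -> nat} => \sum_k f k)%N)
  := discrete_ffun salgM mh.
congr (discrete_rv M _); apply/funext => w /=.
by apply: eq_bigr => k _; rewrite ffunE.
Qed.

Lemma discrete_add (h h' : T -> nat) : discrete_rv M h ->
  discrete_rv M h' -> discrete_rv M (fun w => h w + h' w)%N.
Proof.
move=> mh mh'; exact: (discrete_comp salgM (fun p : nat * nat => p.1 + p.2)%N
  (discrete_pair salgM mh mh')).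
Qed.

End DiscreteSums.

Lemma sum_ord_addn (F : nat -> nat) (a b : nat) :
  (\sum_(i < a + b) F i = \sum_(i < a) F i + \sum_(i < b) F (a + i))%N.
Proof. by rewrite big_split_ord. Qed.

Section Markov.
Context (R : realType) (n : nat) (N : network R n)
  (d : measure_display) (T : measurableType d) (P : probability T R)
  (dU : measure_display) (U : measurableType dU)
  (X : primitives N P U) (pi : nvec n -> U -> nvec n).
Hypothesis pi_policy : is_policy N pi.

Let G := primitive_sigma (arr X) (svc X) (rte X) (tie X).
Let sg := generated G.

Let indepG : mutually_independent P G. Proof. exact: primitives_indep. Qed.

Lemma primitive_salg i : sigma_algebra setT (G i).
Proof.
by case: i => [j t|j u|j m|t]; apply: sigma_algebra_preimage => //;
  exact: sigma_algebra_measurable.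
Qed.

Let salg J : sigma_algebra setT (sg J). Proof. exact: generated_salg. Qed.

Lemma arr_discrete J j t : J (ArrivalIx j t) ->
  discrete_rv (sg J) (arr X j t).
Proof.
move=> Jj k; apply: (generated_sub Jj); exists [set k] => //.
by rewrite setTI.
Qed.

Lemma svc_discrete J j u : J (ServiceIx j u) ->
  discrete_rv (sg J) (svc X j u).
Proof.
move=> Jj k; apply: (generated_sub Jj); exists [set k] => //.
by rewrite setTI.
Qed.

Lemma rte_discrete J j m : J (RouteIx j m) ->
  discrete_rv (sg J) (rte X j m).
Proof.
move=> Jj k; apply: (generated_sub Jj); exists [set k] => //.
by rewrite setTI.
Qed.

Lemma policy_discrete J q t : J (TieIx n t) ->
  discrete_rv (sg J) (fun w => pi q (tie X t w)).
Proof.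
move=> Jj k; apply: (generated_sub Jj); exists [set u | pi q u = k].
  exact: pi_policy.2.
by rewrite setTI.
Qed.

Lemma sg_discrete_rv J (I : Type) (h : T -> I) :
  discrete_rv (sg J) h -> discrete_rv measurable h.
Proof. by move=> mh k; exact: (generated_measurable indepG (mh k)). Qed.

Section StepData.
Variable q : nvec n.

Let m := (\sum_j q j)%N.

(* The primitives consumed in one slot from queue lengths [q] (arrivals,
   schedule, service outcomes, destinations) when [s j] units of service and
   [e j] routings have been used at [j] before. At most [q j <= m] services
   and routings at [j] matter. *)
Definition step_type : countType :=
  (nvec n * nvec n * {ffun 'I_n * 'I_m -> bool} *
   {ffun 'I_n * 'I_m -> option 'I_n})%type.

Definition step_data (t : nat) (s e : nvec n) (w : T) : step_type :=
  ([ffun j => arr X j t w], pi q (tie X t w),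
   [ffun p : 'I_n * 'I_m => svc X p.1 (s p.1 + p.2)%N w],
   [ffun p : 'I_n * 'I_m => rte X p.1 (e p.1 + p.2)%N w]).

Definition step_departures (z : step_type) (j : 'I_n) : nat :=
  (\sum_(u < m | (u < minn (z.1.1.2 j) (q j))%N) z.1.2 (j, u))%N.

Definition step_queue (z : step_type) : nvec n :=
  [ffun j => q j + z.1.1.1 j +
    \sum_k \sum_(i < m | (i < step_departures z k)%N) (z.2 (k, i) == Some j)
    - step_departures z j]%N.

Definition data_index : finType :=
  ('I_n + unit + ('I_n * 'I_m + 'I_n * 'I_m))%type.

Definition data_primitive (t : nat) (s e : nvec n) (i : data_index) :
    primitive_index n :=
  match i with
  | inl (inl j) => ArrivalIx j t
  | inl (inr _) => TieIx n t
  | inr (inl p) => ServiceIx p.1 (s p.1 + p.2)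
  | inr (inr p) => RouteIx p.1 (e p.1 + p.2)
  end.

Definition data_event (z : step_type) (t : nat) (s e : nvec n)
    (i : data_index) : set T :=
  match i with
  | inl (inl j) => [set w | arr X j t w = z.1.1.1 j]
  | inl (inr _) => [set w | pi q (tie X t w) = z.1.1.2]
  | inr (inl p) => [set w | svc X p.1 (s p.1 + p.2)%N w = z.1.2 p]
  | inr (inr p) => [set w | rte X p.1 (e p.1 + p.2)%N w = z.2 p]
  end.

Lemma data_primitive_inj t s e : injective (data_primitive t s e).
Proof.
move=> [[j|[]]|[[j u]|[j u]]] [[k|[]]|[[k v]|[k v]]] //= [].
- by move=> ->.
- by move=> -> /addnI/val_inj ->.
- by move=> -> /addnI/val_inj ->.
Qed.

(** By independence the law is a product over the primitives consumed, and the factors do not depend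
    on the counters because each stream is identically distributed. *)
Lemma step_data_law t s e z :
  P [set w | step_data t s e w = z] =
  P [set w | step_data 0 [ffun=> 0%N] [ffun=> 0%N] w = z].
Proof.
have law t' s' e' : P [set w | step_data t' s' e' w = z] =
    (\prod_i P (data_event z t' s' e' i))%E.
  rewrite -(indep_fintype indepG (@data_primitive_inj t' s' e')); last first.
    case=> [[j|[]]|[p|p]] /=.
    - by exists [set z.1.1.1 j]; rewrite ?setTI.
    - by exists [set u | pi q u = z.1.1.2]; rewrite ?setTI//; exact: pi_policy.2.
    - by exists [set z.1.2 p]; rewrite ?setTI.
    - by exists [set z.2 p]; rewrite ?setTI.
  congr (P _); apply/seteqP; split => [w /= <- [[j|[]]|[p|p]] _ //=|w h].
  - by rewrite ffunE.
  - by rewrite ffunE.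
  - by rewrite ffunE.
  rewrite /= /step_data; case: z h => [[[za zp] zs] zr] h.
  congr (_, _, _, _).
  - by apply/ffunP => j; rewrite ffunE; exact: (h (inl (inl j))).
  - exact: (h (inl (inr tt))).
  - by apply/ffunP => p; rewrite ffunE; exact: (h (inr (inl p))).
  - by apply/ffunP => p; rewrite ffunE; exact: (h (inr (inr p))).
rewrite !law; apply: eq_bigr => -[[j|[]]|[p|p]] _ /=.
- exact: arr_ident.
- exact: (tie_ident X t (pi_policy.2 q z.1.1.2)).
- case: (z.1.2 p); first exact: etrans (svc_law X _ _) (esym (svc_law X _ _)).
  have svcF u : P [set w | svc X p.1 u w = false] =
      (1 - (completion_prob N p.1)%:E)%E.
    rewrite -(svc_law X p.1 u) -probability_setC; last first.
      apply: (sg_discrete_rv (J := setT)).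
      exact: svc_discrete.
    by congr (P _); apply/seteqP; split => w /=; case: (svc X p.1 u w).

  exact: etrans (svcF _) (esym (svcF _)).
- exact: etrans (rte_law X _ _ _) (esym (rte_law X _ _ _)).
Qed.

Lemma step_data_discrete J t s e :
  (forall i, J (data_primitive t s e i)) ->
  discrete_rv (sg J) (step_data t s e).
Proof.
move=> HJ; rewrite /step_data; apply: discrete_pair => //.
  apply: discrete_pair => //; first apply: discrete_pair => //.
  - apply: discrete_ffun => // j; apply: arr_discrete.
    exact: (HJ (inl (inl j))).
  - by apply: policy_discrete; exact: (HJ (inl (inr tt))).
  - apply: discrete_ffun => // p; apply: svc_discrete.
    exact: (HJ (inr (inl p))).
apply: discrete_ffun => // p; apply: rte_discrete.
exact: (HJ (inr (inr p))).
Qed.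

End StepData.

(* The primitives that the path up to time [t] can have used, when [s] is the
   cumulative service and [e] the cumulative number of departures. *)
Definition past (t : nat) (s e : nvec n) : set (primitive_index n) :=
  fun i => match i with
  | ArrivalIx _ r => (r < t)%N
  | ServiceIx j u => (u < s j)%N
  | RouteIx j m => (m < e j)%N
  | TieIx r => (r < t)%N
  end.

(** The counters accompany the queue lengths because they tell which primitives have been
    consumed. *)
Definition full_state (x : nvec n) (t : nat) (w : T) : nvec n * nvec n * nvec n :=
  (queue_process X pi x t w, service X pi x t w,
   [ffun j => departures X pi x t j w]).

Lemma full_state0 x w : full_state x 0 w = (x, [ffun=> 0%N], [ffun=> 0%N]).
Proof.
have dep0 j : departures X pi x 0 j w = 0%N.
  by rewrite /departures /departures_of /= ffunE /completed big_ord0.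
congr (_, _, _); apply/ffunP => j; rewrite !ffunE ?dep0//.
rewrite -/(departures X pi x 0 j w) dep0 subn0 /arrivals_of /external big_ord0.
rewrite add0n big1 ?addn0// => k _.
by rewrite -/(departures X pi x 0 k w) dep0 /routed big_ord0.
Qed.

Lemma full_stateS x t w q s e : full_state x t w = (q, s, e) ->
  let s' := [ffun j => s j + minn (pi q (tie X t w) j) (q j)]%N in
  let e' := [ffun j => e j + \sum_(u < s' j - s j) svc X j (s j + u) w]%N in
  full_state x t.+1 w = ([ffun j => q j + arr X j t w +
    \sum_k \sum_(i < e' k - e k) (rte X k (e k + i) w == Some j) -
    (e' j - e j)]%N, s', e').
Proof.
move=> [Eq Es Ee] s' e'.
have S' : service X pi x t.+1 w = s'.
  by apply/ffunP => j; rewrite /= -/(queue_process X pi x t w) Eq Es !ffunE.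
have Eej j : departures X pi x t j w = e j by rewrite -Ee ffunE.
have E' j : departures X pi x t.+1 j w = e' j.
  have s'j : s' j = (s j + minn (pi q (tie X t w) j) (q j))%N by rewrite ffunE.
  rewrite /departures /departures_of S' /e' [RHS]ffunE s'j addKn /completed.
  rewrite (sum_ord_addn (fun v => svc X j v w : nat)).
  by congr (_ + _)%N; rewrite -Eej /departures /departures_of Es.
rewrite /full_state S'; congr (_, _, _); last by apply/ffunP => j; rewrite ffunE.
apply/ffunP => j; rewrite [RHS]ffunE /queue_process ffunE.
rewrite -/(departures X pi x t.+1 j w) -/(arrivals X pi x t.+1 j w) E'.
have e_le k : (e k <= e' k)%N by rewrite /e' ffunE leq_addr.
have -> : (arrivals X pi x t.+1 j w = arrivals X pi x t j w + arr X j t w +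
    \sum_k \sum_(i < e' k - e k) (rte X k (e k + i) w == Some j))%N.
  rewrite /arrivals /arrivals_of /external big_ord_recr /= -!addnA.
  congr (_ + _)%N; rewrite addnCA; congr (_ + _)%N.
  rewrite -big_split /=; apply: eq_bigr => k _.
  rewrite -/(departures X pi x t.+1 k w) -/(departures X pi x t k w) E' Eej.
  rewrite -{1}(subnKC (e_le k)) /routed.
  by rewrite (sum_ord_addn (fun i => rte X k i w == Some j : nat)).
have := queue_processE X pi x t j w; rewrite Eq Eej => qe.
rewrite -[X in (_ + X)%N]addnA addnA -qe -{1}(subnKC (e_le j)).
by rewrite -addnA addnCA subnDl addnA.
Qed.

(** The sums over the services and routings actually used are widened to the fixed range of
    [step_data]. *)
Lemma queue_step x t w q s e : full_state x t w = (q, s, e) ->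
  queue_process X pi x t.+1 w = step_queue (step_data q t s e w).
Proof.
move=> H; have [-> _ _] := full_stateS H.
have q_le j : (minn (pi q (tie X t w) j) (q j) <= \sum_j q j)%N.
  by rewrite (leq_trans (geq_minr _ _))// (bigD1 j)//= leq_addr.
pose e' j := (\sum_(u < minn (pi q (tie X t w) j) (q j)) svc X j (s j + u) w)%N.
have dE j : step_departures (step_data q t s e w) j = e' j.
  rewrite /step_departures /e' /=.
  rewrite (big_ord_widen _ (fun u => svc X j (s j + u)%N w : nat) (q_le j)).
  by apply: eq_bigr => u _; rewrite ffunE.
have e'_le j : (e' j <= \sum_j q j)%N.
  apply: leq_trans (q_le j); rewrite -[leqRHS]card_ord -sum1_card.
  by apply: leq_sum => u _; exact: leq_b1.
apply/ffunP => j; rewrite !ffunE addKn dE addKn -/(e' j).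
congr (_ + _ - _)%N.
apply: eq_bigr => k _; rewrite !ffunE !addKn -/(e' k) dE.
rewrite (big_ord_widen _ (fun i => rte X k (e k + i)%N w == Some j : nat) (e'_le k)).
by apply: eq_bigr => i _; rewrite /= ffunE.
Qed.

Local Notation avoid := (avoiding (queue_process X pi)).

(** Induction on [t], splitting over the full state one slot earlier. How many primitives the path
    reads is random, but it is determined once the final counters are prescribed. *)
Lemma past_event (F : set (nvec n)) x t v :
  sg (past t v.1.2 v.2) (avoid F x t `&` [set w | full_state x t w = v]).
Proof.
elim: t v => [|t IH] [[q' s'] e'] /=.
  have [sg0 _ _] := salg (past 0 s' e').
  have [sgT _ _ _] := (sigma_algebraP (fun X _ => @subsetT _ X)).1
    (salg (past 0 s' e')).
  have -> : avoid F x 0 = setT.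
    apply/seteqP; split => // w _ i.
    by rewrite leqn0 => /andP[i0 /eqP i00]; rewrite i00 in i0.
  rewrite setTI.
  have [xE|nxE] := pselect ((x, [ffun=> 0%N], [ffun=> 0%N]) = (q', s', e')).
    rewrite (_ : [set _ | _] = setT)//; apply/seteqP; split => // w _ /=.
    by rewrite full_state0.
  rewrite (_ : [set _ | _] = set0)//; apply/seteqP; split => // w /=.
  by rewrite full_state0.
(* The slot leads from [v] to [(q', s', e')], with [q'] outside [F]. The sums run up to the
   prescribed [s'] and [e'] instead of the random counters, so that only fixed primitives occur. *)
pose E (v : nvec n * nvec n * nvec n) : set T :=
  [set w | ~ F q'] `&`
  ([set w | [ffun j => v.1.2 j + minn (pi v.1.1 (tie X t w) j) (v.1.1 j)]%N = s'] `&`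
  ([set w | [ffun j => v.2 j + \sum_(u < s' j - v.1.2 j) svc X j (v.1.2 j + u) w]%N
     = e'] `&`
  [set w | [ffun j => v.1.1 j + (arr X j t w +
    \sum_k \sum_(i < e' k - v.2 k) (rte X k (v.2 k + i) w == Some j)) -
    (e' j - v.2 j)]%N = q'])).
pose B k := if choice.unpickle k is Some v then
  (avoid F x t `&` [set w | full_state x t w = v]) `&` E v else set0.
have -> : avoid F x t.+1 `&` [set w | full_state x t.+1 w = (q', s', e')] =
    \bigcup_k B k.
  rewrite avoidingS; apply/seteqP; split => [w [[aw Fw] /= sw]|w [k _]].
    exists (choice.pickle (full_state x t w)) => //.
    rewrite /B choice.pickleK; split => //.
    case E0 : (full_state x t w) => [[q s] e].
    have := full_stateS E0; rewrite sw => -[q'E s'E e'E].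
    have F' : ~ F q' by have [-> _ _] := esym sw.
    split => //; split; first exact: esym s'E.
    split; first by rewrite /= [RHS]e'E -s'E.
    rewrite /= [RHS]q'E -e'E; apply/ffunP => j.
    by rewrite [LHS]ffunE [RHS]ffunE addnA.
  rewrite /B; case: choice.unpickle => // -[[q s] e].
  move=> [[aw /= sw] [Fw /= [s'E [e'E q'E]]]].
  have := full_stateS sw; rewrite /= s'E => sw'.
  suff sw2 : full_state x t.+1 w = (q', s', e').
    by split => //; split => //=; have [-> _ _] := sw2.
  rewrite sw' e'E; congr (_, _, _); rewrite -q'E.
  by apply/ffunP => j; rewrite !ffunE addnA.
have [sg0 _ sgU] := salg (past t.+1 s' e').
apply: sgU => k; rewrite /B; case: choice.unpickle => [v|//].
(* Counters never decrease: larger ones in [v] give the empty event, and otherwise the past at [v]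
   lies in the new past. *)
have [ss'|nss'] := boolP [forall j, v.1.2 j <= s' j]%N; last first.
  rewrite (_ : _ `&` E v = set0)//; apply/seteqP; split => // w [_ [_ [/= s'E _]]].
  move: nss' => /forallP; apply => j.
  by rewrite -s'E ffunE leq_addr.
have [ee'|nee'] := boolP [forall j, v.2 j <= e' j]%N; last first.
  rewrite (_ : _ `&` E v = set0)//; apply/seteqP; split => // w [_ [_ [_ [/= e'E _]]]].
  move: nee' => /forallP; apply => j.
  by rewrite -e'E ffunE leq_addr.
apply: (discrete_setI (salg _)).
  apply: generated_mono (IH v) => -[j r|j u|j i|r] /=.
  - by move=> /leqW.
  - by move=> /leq_trans; apply; exact: (forallP ss').
  - by move=> /leq_trans; apply; exact: (forallP ee').
  - by move=> /leqW.
rewrite /E; apply: (discrete_setI (salg _)).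
  have [Fq'|nFq'] := pselect (F q').
    by rewrite (_ : [set _ | _] = set0)//; apply/seteqP; split.
  rewrite (_ : [set _ | _] = setT); last by apply/seteqP; split.
  by have [] := (sigma_algebraP (fun X _ => @subsetT _ X)).1
    (salg (past t.+1 s' e')).
apply: (discrete_setI (salg _)).
  apply: (discrete_preimage (salg _) (fun p : nvec n =>
    [ffun j => v.1.2 j + minn (p j) (v.1.1 j)]%N = s')).
  by apply: policy_discrete => /=.
apply: (discrete_setI (salg _)).
  apply: discrete_ffun => // j; apply: discrete_add => //.
    move=> c; have [vc|vc] := pselect (v.2 j = c).
      rewrite (_ : [set _ | _] = setT); last by apply/seteqP; split.
      by have [] := (sigma_algebraP (fun X _ => @subsetT _ X)).1
        (salg (past t.+1 s' e')).
    by rewrite (_ : [set _ | _] = set0)//; apply/seteqP; split.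
  apply: discrete_sum => // u; apply: (discrete_comp (salg _) nat_of_bool).
  by apply: svc_discrete; rewrite /= -ltn_subRL.
apply: discrete_ffun => // j.
apply: (discrete_comp (salg _) (fun c => v.1.1 j + c - (e' j - v.2 j))%N).
apply: discrete_add => //; first by apply: arr_discrete => /=.
apply: discrete_sum => // k'; apply: discrete_sum => // i.
apply: (discrete_comp (salg _) (fun o => (o == Some j : nat))).
by apply: rte_discrete; rewrite /= -ltn_subRL.
Qed.

Lemma past_data_disjoint (q : nvec n) t s e (i : data_index q) :
  ~ past t s e (data_primitive t s e i).
Proof.
by case: i => [[j|[]]|[[j u]|[j u]]] /=; rewrite ?ltnn// ltnNge leq_addr.
Qed.

Lemma full_state_discrete x t : discrete_rv measurable (full_state x t).
Proof.
move=> v; have := generated_measurable indepG (@past_event set0 x t v).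
rewrite (_ : avoid set0 x t = setT) ?setTI//.
by apply/seteqP; split => // w _ i _ [].
Qed.

Lemma queue_process_discrete x t :
  discrete_rv measurable (queue_process X pi x t).
Proof.
exact: (discrete_comp (@sigma_algebra_measurable _ T)
  (fun v : nvec n * nvec n * nvec n => v.1.1) (full_state_discrete x t)).
Qed.

Lemma queue_process_markovian : markovian P (queue_process X pi).
Proof.
move=> F x t f f0.
pose Kf := transition P (queue_process X pi) f.
have Kf0 y : (0 <= Kf y)%E by apply: integral_ge0 => w _; exact: f0.
have dQ := queue_process_discrete.
have mA : measurable (avoid F x t).
  exact: (measurable_avoiding (fun x t y => dQ x t y)).
rewrite (integral_partition P (full_state_discrete x t))//; last first.
  exact: (discrete_measurable_fun f (dQ x t.+1)).
rewrite [RHS](integral_partition P (full_state_discrete x t))//; last first.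
  exact: (discrete_measurable_fun Kf (dQ x t)).
apply: eq_eseriesr => k _; case: choice.unpickle => [v|//].
have [vk|nvk] := eqVneq (choice.pickle v) k; last first.
  rewrite (_ : _ `&` _ = set0) ?integral_set0//.
  by apply/seteqP; split => // w [_ [_ /eqP]]; rewrite (negbTE nvk).
rewrite (_ : [set w | full_state x t w = v /\ _] = [set w | full_state x t w = v]);
  last by apply/seteqP; split => [w []|w].
set E := avoid F x t `&` _.
have sE : sg (past t v.1.2 v.2) E by exact: past_event.
have mE : measurable E by exact: (generated_measurable indepG sE).
(* On [E] the next queue lengths are [Z t v.1.2 v.2], which reads only primitives outside the past,
   whereas [E] is a past event. *)
pose Z t s e w := step_queue (step_data v.1.1 t s e w).
have dZ t' s' e' : discrete_rv (sg (~` past t' s' e')) (Z t' s' e').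
  apply: (discrete_comp (salg _) _ (step_data_discrete _)) => i.
  exact: past_data_disjoint.
have mZ t' s' e' : discrete_rv measurable (Z t' s' e').
  exact: sg_discrete_rv (dZ t' s' e').
have -> : (\int[P]_(w in E) f (queue_process X pi x t.+1 w) =
    \int[P]_(w in E) f (Z t v.1.2 v.2 w))%E.
  apply: eq_integral => w /set_mem[_ /= sw].
  by rewrite (@queue_step _ _ _ v.1.1 v.1.2 v.2)// sw; case: (v) => [[]].
have -> : (\int[P]_(w in E) Kf (queue_process X pi x t w) =
    \int[P]_(w in E) cst (Kf v.1.1) w)%E.
  by apply: eq_integral => w /set_mem[_ /= <-].
rewrite integral_cst// muleC.
have PEfin : P E \is a fin_num by exact: fin_num_measure.
rewrite -[X in _ = (X * _)%E](fineK PEfin).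
(* The law of [Z] does not depend on the counters, so the step is compared with the first slot of
   the chain started at [v.1.1]. *)
rewrite (integral_discrete_scale (c := fine (P E))
  (h' := Z 0%N [ffun=> 0%N] [ffun=> 0%N])) //.
  congr (_ * _)%E; rewrite /Kf /transition; apply: eq_integral => w _.
  by rewrite (queue_step (full_state0 _ _)).
move=> i; rewrite fineK//.
have -> : P [set w | Z 0%N [ffun=> 0%N] [ffun=> 0%N] w = i] =
    P [set w | Z t v.1.2 v.2 w = i].
  have dS t' s' e' : discrete_rv measurable (step_data v.1.1 t' s' e').
    apply: (sg_discrete_rv (J := setT)); exact: step_data_discrete.
  apply: (law_preimage (fun z => step_queue z = i)) => // z.
  exact/esym/step_data_law.
apply: (generated_indep indepG primitive_salg (J1 := past t v.1.2 v.2)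
  (J2 := ~` past t v.1.2 v.2)) => //; first exact: setICr.
exact: dZ.
Qed.

End Markov.
(** * Drift under weighted MaxWeight *)

Section Mean.
Context (R : realType) (d : measure_display) (T : measurableType d)
  (P : probability T R).
Implicit Types f g : T -> R.

Definition has_mean f (m : R) : Prop :=
  P.-integrable setT (EFin \o f) /\ (\int[P]_w (f w)%:E = m%:E)%E.

Lemma has_mean_unique f m m' : has_mean f m -> has_mean f m' -> m = m'.
Proof. by move=> [_ fm] [_]; rewrite fm => -[]. Qed.

Lemma has_mean_ext f g m : f =1 g -> has_mean f m -> has_mean g m.
Proof. by move=> /funext ->. Qed.

Lemma has_mean_cst c : has_mean (fun=> c) c.
Proof.
split; first exact: finite_measure_integrable_cst.
by rewrite integral_cst// -[RHS]mule1; congr (_ * _)%E; exact: probability_setT.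
Qed.

Lemma has_meanD f g m m' : has_mean f m -> has_mean g m' ->
  has_mean (fun w => f w + g w) (m + m').
Proof.
move=> [If mf] [Ig mg]; split.
  rewrite (_ : _ \o _ = (EFin \o f) \+ (EFin \o g))%E; last exact/funext.
  exact: integrableD.
by rewrite -[RHS]/(m%:E + m'%:E)%E -mf -mg -(integralD_EFin _ If Ig).
Qed.

Lemma has_meanZ c f m : has_mean f m -> has_mean (fun w => c * f w) (c * m).
Proof.
move=> [If mf]; split.
  rewrite (_ : _ \o _ = (fun w => c%:E * (EFin \o f) w))%E; last exact/funext.
  exact: integrableZl.
under eq_integral => w _ do rewrite EFinM.
by rewrite integralZl// mf EFinM.
Qed.

Lemma has_mean_sum (K : finType) (f : K -> T -> R) (m : K -> R) :
  (forall k, has_mean (f k) (m k)) ->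
  has_mean (fun w => \sum_k f k w) (\sum_k m k).
Proof.
move=> fm; elim: (index_enum K) => [|k s IH].
  under [X in has_mean X]eq_fun => w do rewrite big_nil.
  by rewrite big_nil; exact: has_mean_cst.
under [X in has_mean X]eq_fun => w do rewrite big_cons.
by rewrite big_cons; exact: has_meanD.
Qed.

Lemma has_mean_le f g m m' : (forall w, f w <= g w) ->
  has_mean f m -> has_mean g m' -> m <= m'.
Proof.
move=> fg [If mf] [Ig mg]; rewrite -lee_fin -mf -mg.
by apply: le_integral => // w _; rewrite lee_fin.
Qed.

Lemma has_mean_bool (b : T -> bool) : discrete_rv measurable b ->
  has_mean (fun w => (b w)%:R) (fine (P [set w | b w])).
Proof.
move=> mb; have mB : measurable [set w | b w] by exact: (mb true).
have bE : (fun w => (b w)%:R : R) = \1_[set w | b w].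
  apply/funext => w; rewrite indicE; congr (_%:R); congr nat_of_bool.
  by apply/idP/idP => [bw|/set_mem//]; rewrite mem_set.
rewrite bE; split; first exact: integrable_indic.
rewrite integral_indic// setIT fineK//.
exact: fin_num_measure.
Qed.

(** Dominated convergence along [beta = k.+1%:R^-1]: the integrand tends to 0 pointwise and is at
    most [4 * M w]. *)
Lemma has_mean_truncated_square (M : T -> R) m e : (forall w, 0 <= M w) ->
  has_mean M m -> 0 < e -> exists beta, 0 < beta /\
  exists2 r, r <= e &
    has_mean (fun w => 4 * M w * Order.min 1 (beta * M w)) r.
Proof.
move=> M0 [IM mM] e0.
pose f (k : nat) w : R := 4 * M w * Order.min 1 (k.+1%:R^-1 * M w).
have mMf : measurable_fun setT M by exact/measurable_EFinP/(measurable_int _ IM).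
have mf k : measurable_fun setT (f k).
  apply: measurable_funM; first exact: measurable_funM.
  by apply: measurable_minr => //; exact: measurable_funM.
have f0 k w : 0 <= f k w.
  by rewrite /f !mulr_ge0// le_min ler01 mulr_ge0.
have fle k w : f k w <= 4 * M w.
  by rewrite /f ler_piMr ?mulr_ge0// ge_min lexx.
have I4M : P.-integrable setT (EFin \o (fun w => 4 * M w)).
  by case: (has_meanZ 4 (conj IM mM)).
have cvgf w : f ^~ w @ \oo --> (0 : R).
  apply: (@squeeze_cvgr _ _ _ _ (fun=> 0) (fun k => 4 * M w * M w * harmonic k)).
  - apply: nearW => k; rewrite f0 /=.
    rewrite /f -[leRHS]mulrA ler_wpM2l ?mulr_ge0// [leRHS]mulrC.
    by rewrite /harmonic ge_min lexx orbT.
  - exact: cvg_cst.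
  - rewrite -[X in _ --> X](mulr0 (4 * M w * M w)).
    by apply: cvgMr => //; exact: cvg_harmonic.
have := @dominated_convergence _ _ _ P setT measurableT
  (fun k => EFin \o f k) (cst 0%E) (EFin \o (fun w => 4 * M w)).
move=> /(_ _ _ _ I4M _)[].
- by move=> k; exact/measurable_EFinP.
- exact: measurable_cst.
- by apply/aeW => w _; apply/cvg_EFin; [exact: nearW|exact: cvgf].
- by apply/aeW => w k _ /=; rewrite lee_fin ger0_norm.
move=> _ _; rewrite integral0 => /(_ [set x | (x < e%:E)%E]) H.
have [k _ /(_ k (leqnn _)) /= fke] : \forall k \near \oo,
    (\int[P]_w (f k w)%:E < e%:E)%E.
  apply: H; apply: open_nbhs_nbhs; split; first exact: open_ereal_lt_ereal.
  by rewrite /= lte_fin.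
exists k.+1%:R^-1; split; first by rewrite invr_gt0.
have Ifk : P.-integrable setT (EFin \o f k).
  apply: le_integrable I4M => //; first exact/measurable_EFinP.
  by move=> w _ /=; rewrite lee_fin !ger0_norm// mulr_ge0.
have fkfin : (\int[P]_w (f k w)%:E)%E \is a fin_num by exact: integrable_fin_num.
exists (fine (\int[P]_w (f k w)%:E)); first by rewrite -lee_fin fineK// ltW.
by split => //; rewrite fineK.
Qed.

End Mean.

Lemma finite_bounded_vectors (n m : nat) :
  finite_set [set q : nvec n | forall j, (q j <= m)%N].
Proof.
pose F := [set [ffun j => f j : nat] | f in [set: {ffun 'I_n -> 'I_m.+1}]].
apply: (@sub_finite_set _ _ F).
  move=> q qm; exists [ffun j => inord (q j)] => //.
  by apply/ffunP => j; rewrite !ffunE inordK// ltnS.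
by apply: finite_image; exact: finite_finset.
Qed.

(** * Mean increments over one slot *)

Section Drift.
Context (R : realType) (n : nat) (N : network R n)
  (d : measure_display) (T : measurableType d) (P : probability T R)
  (dU : measure_display) (U : measurableType dU)
  (X : primitives N P U) (pi : nvec n -> U -> nvec n).
Hypothesis pi_policy : is_policy N pi.

Let G := primitive_sigma (arr X) (svc X) (rte X) (tie X).
Let indepG : mutually_independent P G. Proof. exact: primitives_indep. Qed.
Let salgG := primitive_salg X.
Let salg J : sigma_algebra setT (generated G J). Proof. exact: generated_salg. Qed.

Definition served (q : nvec n) (w : T) : nvec n :=
  [ffun j => minn (pi q (tie X 0 w) j) (q j)].

Definition departed (q : nvec n) (j : 'I_n) (w : T) : nat :=
  (\sum_(u < served q w j) svc X j u w)%N.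

Definition transferred (q : nvec n) (k j : 'I_n) (w : T) : nat :=
  (\sum_(i < departed q k w) (rte X k i w == Some j))%N.

Lemma departed_le_served q j w : (departed q j w <= served q w j)%N.
Proof.
rewrite -[leqRHS]card_ord -sum1_card.
by apply: leq_sum => u _; exact: leq_b1.
Qed.

Lemma served_le q j w : (served q w j <= q j)%N.
Proof. by rewrite ffunE geq_minr. Qed.

Lemma transferred_le q k j w : (transferred q k j w <= departed q k w)%N.
Proof.
rewrite -[leqRHS]card_ord -sum1_card.
by apply: leq_sum => u _; exact: leq_b1.
Qed.

Lemma queue_process1 q w j : (queue_process X pi q 1 w j + departed q j w =
  q j + arr X j 0 w + \sum_k transferred q k j w)%N.
Proof.
have S1 : service X pi q 1 w = served q w.
  have q0 : queues_of X q 0 [ffun=> 0%N] w = q.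
    by have [] := full_state0 X pi q w.
  by apply/ffunP => k; rewrite /= q0 !ffunE.
have D1 k : departures X pi q 1 k w = departed q k w.
  by rewrite /departures /departures_of S1.
rewrite -D1 queue_processE -addnA; congr (_ + _)%N.
rewrite /arrivals /arrivals_of /external big_ord_recr big_ord0 /= add0n.
congr (_ + _)%N; apply: eq_bigr => k _.
by rewrite -/(departures X pi q 1 k w) D1.
Qed.

Lemma served_discrete (J : set (primitive_index n)) q j : J (TieIx n 0) ->
  discrete_rv (generated G J) (fun w => served q w j).
Proof.
move=> J0; have H : discrete_rv (generated G J) (fun w => pi q (tie X 0 w)).
  exact: policy_discrete.
have := discrete_comp (salg J) (fun p : nvec n => minn (p j) (q j)) H.
by congr (discrete_rv _ _); apply/funext => w; rewrite /= ffunE.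
Qed.

(** The random number of summands becomes a condition inside a fixed number of them, so that means
    can be taken term by term. *)
Lemma departed_eq q j w : departed q j w =
  (\sum_(u < q j) ((u < served q w j)%N && svc X j u w))%N.
Proof.
rewrite /departed (big_ord_widen _ (fun u => svc X j u w : nat) (served_le q j w)).
by rewrite big_mkcond; apply: eq_bigr => u _; case: ifP.
Qed.

Lemma departed_discrete (J : set (primitive_index n)) q j : J (TieIx n 0) ->
  (forall u, J (ServiceIx j u)) ->
  discrete_rv (generated G J) (departed q j).
Proof.
move=> J0 JS; rewrite (_ : departed q j = fun w =>
    (\sum_(u < q j) ((u < served q w j)%N && svc X j u w))%N); last first.
  by apply/funext => w; exact: departed_eq.
apply: (discrete_sum (salg J)) => u.
apply: (discrete_comp (salg J) (fun p : nat * bool => ((u < p.1)%N && p.2 : nat))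
  (discrete_pair (salg J) (served_discrete q j J0) _)).
exact: svc_discrete.
Qed.

Let mean_and (J1 J2 : set (primitive_index n)) (b1 b2 : T -> bool) (p : R) :
  J1 `&` J2 = set0 -> discrete_rv (generated G J1) b1 ->
  discrete_rv (generated G J2) b2 -> P [set w | b2 w] = p%:E ->
  has_mean P (fun w => (b1 w && b2 w)%:R) (p * fine (P [set w | b1 w])).
Proof.
move=> J12 m1 m2 Pp; rewrite mulrC.
have -> : fine (P [set w | b1 w]) * p = fine (P [set w | b1 w && b2 w]).
  rewrite (_ : [set w | b1 w && b2 w] = [set w | b1 w] `&` [set w | b2 w]).
    rewrite (generated_indep indepG salgG J12 (m1 true) (m2 true)) Pp.
    by rewrite fineM// fin_num_measure//; exact: (generated_measurable indepG (m1 true)).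
  by apply/seteqP; split => [w /andP[]|w [/= -> ->]].
apply: has_mean_bool; have mT := @sigma_algebra_measurable _ T.
apply: (discrete_comp mT (fun p : bool * bool => p.1 && p.2)
  (discrete_pair mT _ _)) => k.
  exact: (generated_measurable indepG (m1 k)).
exact: (generated_measurable indepG (m2 k)).
Qed.

Lemma arr_has_mean j :
  has_mean P (fun w => (arr X j 0 w)%:R) (arrival_rate N ord0 j).
Proof.
split; last exact: arr_mean.
have ma : discrete_rv measurable (arr X j 0).
  move=> k; apply: (generated_measurable indepG (J := setT)).
  exact: arr_discrete.
apply/integrableP; split.
  exact: (discrete_measurable_fun (fun k : nat => k%:R%:E) ma).
under eq_integral => w _ do rewrite /= ger0_norm//.
by rewrite arr_mean ltry.
Qed.

(** Wald's identity, twice: whether the [u]-th unit of service is given depends on the policy's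
    randomness only, hence not on its outcome; whether an [i]-th departure occurs depends on that
    randomness and the services, hence not on its destination. *)
Lemma increment_mean q : exists mv : 'I_n -> R,
  (forall k, has_mean P (fun w => (served q w k)%:R) (mv k)) /\
  forall j, has_mean P
    (fun w => (queue_process X pi q 1 w j)%:R - (q j)%:R)
    (arrival_rate N ord0 j
     + \sum_k routing_mx N k j * (completion_prob N k * mv k)
     - completion_prob N j * mv j).
Proof.
pose pv k u := fine (P [set w | (u < served q w k)%N]).
pose pd k i := fine (P [set w | (i < departed q k w)%N]).
pose Jt := [set i | i = TieIx n 0].
pose Jts : set (primitive_index n) := fun i =>
  match i with TieIx _ | ServiceIx _ _ => True | _ => False end.
have split_sum m (c : nat) : (c <= m)%N -> c = (\sum_(u < m) (u < c)%N)%N.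
  move=> cm; rewrite -[LHS]card_ord -sum1_card.
  rewrite (big_ord_widen _ (fun=> 1%N) cm) big_mkcond.
  by apply: eq_bigr => u _; case: ifP.
have dV k u : discrete_rv (generated G Jt) (fun w => (u < served q w k)%N).
  apply: (discrete_comp (salg Jt) (fun c => (u < c)%N)).
  exact: served_discrete.
have dD k i : discrete_rv (generated G Jts) (fun w => (i < departed q k w)%N).
  apply: (discrete_comp (salg Jts) (fun c => (i < c)%N)).
  exact: departed_discrete.
have meas J I (h : T -> I) : discrete_rv (generated G J) h ->
    discrete_rv measurable h.
  by move=> mh k; exact: (generated_measurable indepG (mh k)).
have mV k : has_mean P (fun w => (served q w k)%:R) (\sum_(u < q k) pv k u).
  have := @has_mean_sum _ _ _ P 'I_(q k) (fun u w => ((u < served q w k)%N : nat)%:R)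
    (fun u => pv k u) (fun u => has_mean_bool P (meas _ _ _ (dV k u))).
  apply: has_mean_ext => w; rewrite -natr_sum; congr _%:R.
  by apply/esym/split_sum; exact: served_le.
have mD k : has_mean P (fun w => (departed q k w)%:R)
    (completion_prob N k * \sum_(u < q k) pv k u).
  rewrite mulr_sumr.
  have term u : has_mean P (fun w => ((u < served q w k)%N && svc X k u w)%:R)
      (completion_prob N k * pv k u).
    apply: (@mean_and Jt [set ServiceIx k u]); [|exact: dV| |exact: svc_law].
      by apply/seteqP; split => // i [/= -> ].
    exact: svc_discrete.
  apply: has_mean_ext (has_mean_sum (fun u : 'I_(q k) => term u)) => w.
  by rewrite -natr_sum departed_eq.
(* The mean number of departures in two ways: by tail probabilities and by completions of the units
   served. *)
have pdE k : \sum_(i < q k) pd k i = completion_prob N k * \sum_(u < q k) pv k u.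
  apply: has_mean_unique (mD k).
  apply: has_mean_ext (has_mean_sum (fun i : 'I_(q k) =>
    has_mean_bool P (meas _ _ _ (dD k i)))) => w.
  rewrite -natr_sum; congr _%:R; apply/esym/split_sum.
  exact: leq_trans (departed_le_served _ _ _) (served_le _ _ _).
have mT k j : has_mean P (fun w => (transferred q k j w)%:R)
    (routing_mx N k j * (completion_prob N k * \sum_(u < q k) pv k u)).
  rewrite -pdE mulr_sumr.
  have term i : has_mean P
      (fun w => ((i < departed q k w)%N && (rte X k i w == Some j))%:R)
      (routing_mx N k j * pd k i).
    apply: (@mean_and Jts [set RouteIx k i]); [|exact: dD| |].
    - by apply/seteqP; split => // i' [/= + iE]; rewrite iE.

    - apply: (discrete_comp (salg _) (fun o => o == Some j)).
      exact: rte_discrete.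
    - rewrite -(rte_law X k i (Some j)); congr (P _).
      by apply/seteqP; split => w /eqP.
  apply: has_mean_ext (has_mean_sum (fun i : 'I_(q k) => term i)) => w.
  rewrite -natr_sum; congr _%:R; rewrite /transferred.
  rewrite (big_ord_widen (q k) (fun i => rte X k i w == Some j : nat)); last first.
    exact: leq_trans (departed_le_served _ _ _) (served_le _ _ _).
  by rewrite [RHS]big_mkcond; apply: eq_bigr => i _; case: ifP.
exists (fun k => \sum_(u < q k) pv k u); split => // j.
have := has_meanD (has_meanD (arr_has_mean j) (has_mean_sum (fun k => mT k j)))
  (has_meanZ (-1) (mD j)).
rewrite mulN1r; apply: has_mean_ext => w /=.
rewrite mulN1r -natr_sum; have := queue_process1 q w j.
move=> /(congr1 (fun k => k%:R : R)); rewrite !natrD.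
lra.
Qed.


Lemma transition_le_mean (W : nvec n -> R) q (f : T -> R) m :
  (forall y, 0 <= W y) -> (forall w, W (queue_process X pi q 1 w) <= f w) ->
  has_mean P f m ->
  (transition P (queue_process X pi) (EFin \o W) q <= m%:E)%E.
Proof.
move=> W0 Wf [If mf]; rewrite -mf; apply: ge0_le_integral => //.
- by move=> w _; rewrite lee_fin.
- exact: (discrete_measurable_fun (EFin \o W) (queue_process_discrete X pi_policy q 1)).
- exact: (measurable_int _ If).
- by move=> w _; rewrite lee_fin.
Qed.

End Drift.

(** * Service under MaxWeight *)

Definition queue_vec (R : realType) (n : nat) (q : nvec n) : 'rV[R]_n :=
  \row_j (q j)%:R.

Definition excess_service (R : realType) (n : nat) (N : network R n)
    (s : nvec n) : 'rV[R]_n :=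
  \row_j ((s j)%:R / load N ord0 j - 1).

Section MaxWeight.
Context (R : realType) (n : nat) (N : network R n)
  (d : measure_display) (T : measurableType d) (P : probability T R)
  (dU : measure_display) (U : measurableType dU)
  (X : primitives N P U) (pi : nvec n -> U -> nvec n).
Hypotheses (pi_policy : is_policy N pi)
  (load_capacity : capacity_region N (load N)).

Local Notation y := (excess_service N).
Local Notation qvec := (@queue_vec R n).

Lemma dotv_excess q s :
  dotv (qvec q) (y s) = weighted_value N q s - \sum_j (q j)%:R.
Proof.
rewrite dotvE -sumrB; apply: eq_bigr => j _.
by rewrite !mxE mulrBr mulr1.
Qed.

Lemma schedules_bounded : exists B : nat,
  forall s, s \in schedules N -> forall j, (s j <= B)%N.
Proof.
exists (\max_(s <- schedules N) \sum_j s j)%N => s sS j.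
apply: leq_trans (leq_bigmax_seq _ sS isT).
by rewrite (bigD1 j)//= leq_addr.
Qed.

Lemma served_schedule q w : served X pi q w \in schedules N.
Proof.
apply: (schedules_down (pi_policy.1 q (tie X 0 w))) => j.
by rewrite ffunE geq_minl.
Qed.

(** Service is lost at [j] only if the queue is shorter than the scheduled service, itself at most
    [B]; the weight lost is then at most [B%:R ^+ 2 / load N ord0 j]. *)
Lemma served_gap (B : nat) q w :
  (forall s, s \in schedules N -> forall j, (s j <= B)%N) ->
  dotv (qvec q) (y (pi q (tie X 0 w))) - \sum_j B%:R ^+ 2 / load N ord0 j <=
  dotv (qvec q) (y (served X pi q w)).
Proof.
move=> HB; rewrite !dotv_excess lerBlDr addrAC lerD2r.
rewrite /weighted_value -big_split; apply: ler_sum => j _ /=.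
have r0 := load_gt0 load_capacity j.
set p := pi q _; have pB : (p j <= B)%N by apply: HB; exact: pi_policy.1.
rewrite !mulrA -mulrDl ler_pM2r ?invr_gt0// ffunE -/p.
have [pq|qp] := leqP (p j) (q j).
  by rewrite lerDl exprn_ge0.
apply: (@le_trans _ _ (B%:R ^+ 2)); last by rewrite lerDr mulr_ge0.
rewrite expr2 ler_pM// ler_nat//.
by rewrite (leq_trans (ltnW qp)).
Qed.

(** Traffic times excess is the completion rate minus the traffic; the traffic equations turn the
    remaining traffic terms into the external arrival rate. *)
Lemma bilin_flow_excess (g : 'rV[R]_n) s : - bilin (flow_mx N) g (y s) =
  \sum_j g ord0 j * (arrival_rate N ord0 j
     + \sum_k routing_mx N k j * (completion_prob N k * (s k)%:R)
     - completion_prob N j * (s j)%:R).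
Proof.
rewrite flow_mxE -sumrN; apply: eq_bigr => j _; rewrite -mulrN; congr (_ * _).
have lamy k : traffic N ord0 k * y s ord0 k =
    completion_prob N k * (s k)%:R - traffic N ord0 k.
  rewrite [y s _ _]mxE [load N _ _]mxE; field.
  by rewrite !gt_eqF ?completion_prob_gt0// traffic_gt0.
rewrite lamy; have -> : \sum_k traffic N ord0 k * routing_mx N k j * y s ord0 k =
    \sum_k routing_mx N k j * (completion_prob N k * (s k)%:R) -
    \sum_k traffic N ord0 k * routing_mx N k j.
  by rewrite -sumrB; apply: eq_bigr => k _; rewrite mulrAC lamy; ring.
by have := traffic_eq N j; lra.
Qed.

(** A slot removes at most [B] jobs from [j] and brings at most [B] from each of the [n] queues. *)
Lemma increment_norm_le (B : nat) q w j :
  (forall s, s \in schedules N -> forall j, (s j <= B)%N) ->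
  `|(queue_process X pi q 1 w j)%:R - (q j)%:R| <=
  (arr X j 0 w)%:R + (n.+1 * B)%N%:R :> R.
Proof.
move=> HB; have dB k : (departed X pi q k w <= B)%N.
  apply: leq_trans (departed_le_served _ _ _ _ _) _.
  by apply: HB; exact: served_schedule.
have sT : (\sum_k transferred X pi q k j w <= n * B)%N.
  rewrite -[X in (_ <= X * _)%N]card_ord -sum_nat_const; apply: leq_sum => k _.
  exact: leq_trans (transferred_le _ _ _ _ _ _) (dB k).
have /(congr1 (fun k => k%:R : R)) := queue_process1 X pi q w j.
rewrite mulSn !natrD => e.
move: sT (dB j); rewrite -!(ler_nat R) => sT dj.
have := ler0n R (departed X pi q j w).
have := ler0n R (\sum_k transferred X pi q k j w)%N.
have := ler0n R (arr X j 0 w).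
rewrite ler_norml => a0 t0 d0.
by apply/andP; split; lra.
Qed.

End MaxWeight.

Theorem theorem2 (R : realType) (n : nat) (N : network R n)
    (d : measure_display) (T : measurableType d) (P : probability T R)
    (dU : measure_display) (U : measurableType dU)
    (X : primitives N P U) (pi : nvec n -> U -> nvec n)
    (pi_policy : is_policy N pi)
    (pi_maxweight : weighted_maxweight N pi)
    (load_capacity : capacity_region N (load N)) :
  positive_recurrent P (queue_process X pi).
Proof.
have [B HB] := schedules_bounded N.
pose kappa : R := \sum_j B%:R ^+ 2 / load N ord0 j.
have kappa0 : 0 <= kappa.
  by apply: sumr_ge0 => j _; rewrite divr_ge0 ?exprn_ge0// ltW// load_gt0.
have [g [c [c0 Hg]]] := @lyapunov_directions R (schedules N) n (flow_mx N)
  (fun i => excess_service N (val i)) kappa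
  (fun x => flow_mx_gt0 (traffic_gt0 load_capacity)) kappa0.
pose gm := \sum_F \sum_j `|g F ord0 j|.
have gm0 : 0 <= gm by apply: sumr_ge0 => F _; exact: sumr_ge0.
have gle F j : `|g F ord0 j| <= gm.
  rewrite /gm (bigD1 F)//= (bigD1 j)//= -addrA lerDl addr_ge0//.
    exact: sumr_ge0.
  by apply: sumr_ge0 => F' _; exact: sumr_ge0.
(* Dominates the one-slot increments of all the affine functions. *)
pose M w : R := gm * \sum_j ((arr X j 0 w)%:R + (n.+1 * B)%N%:R).
have M0 w : 0 <= M w by rewrite mulr_ge0// sumr_ge0.
have MM : has_mean P M (gm * \sum_j (arrival_rate N ord0 j + (n.+1 * B)%N%:R)).
  apply: has_meanZ; apply: has_mean_sum => j; apply: has_meanD.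
    exact: arr_has_mean.
  exact: has_mean_cst.
(* The mean of the second-order remainder is at most half of the drift [c]. The offsets and the
   threshold depend on [beta] and come after it. *)
have [beta [beta0 [r rle Mr]]] :=
  has_mean_truncated_square M0 MM (divr_gt0 c0 (ltr0n R 2)).
have [b [thr [[F0 [gF0 bF0]] Hb]]] := Hg beta beta0.
pose l q F := dotv (queue_vec R q) (g F) + b F.
pose W q := softmax beta (l q).
pose Gq q := \sum_F softmax_weight beta (l q) F *: g F.
pose dq q w : 'rV[R]_n :=
  \row_j ((queue_process X pi q 1 w j)%:R - (q j)%:R).
have W0 q : 0 <= W q.
  apply: (softmax_ge0 beta0 (j := F0)); rewrite /l gF0 bF0 addr0 dotvE.
  by rewrite sumr_ge0// => j _; rewrite [X in _ * X]mxE mulr0.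
have dqM q w F : `|dotv (dq q w) (g F)| <= M w.
  rewrite dotvE /M mulr_sumr; apply: le_trans (ler_norm_sum _ _ _) _.
  apply: ler_sum => j _; rewrite normrM mulrC ler_pM// mxE.
  exact: (increment_norm_le X pi_policy).
have Wle q w : W (queue_process X pi q 1 w) <=
    W q + \sum_F softmax_weight beta (l q) F * dotv (dq q w) (g F) +
    4 * M w * Order.min 1 (beta * M w).
  have -> : W (queue_process X pi q 1 w) =
      softmax beta (fun F => l q F + dotv (dq q w) (g F)).
    rewrite /W; congr (softmax _ _); apply/funext => F.
    rewrite /l addrAC; congr (_ + _); rewrite !dotvE -big_split.
    by apply: eq_bigr => j _ /=; rewrite !mxE; ring.
  exact: (softmax_increment beta0 (l q) finset.set0 (dqM q w)).
(* The factor 5 counts [M w] for the first-order term and [4 * M w] for the remainder. *)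
have Wgrowth q : (transition P (queue_process X pi) (EFin \o W) q <=
    (W q + 5 * (gm * \sum_j (arrival_rate N ord0 j + (n.+1 * B)%N%:R)))%:E)%E.
  apply: (transition_le_mean pi_policy W0 (f := fun w => W q + 5 * M w)).
    move=> w; apply: le_trans (Wle q w) _.
    have : \sum_F softmax_weight beta (l q) F * dotv (dq q w) (g F) <= M w.
      rewrite -[leRHS]mul1r -(sum_softmax_weight beta (l q) finset.set0).
      rewrite mulr_suml; apply: ler_sum => F _.
      rewrite ler_wpM2l ?softmax_weight_ge0//.
      exact: le_trans (ler_norm _) (dqM q w F).
    have : 4 * M w * Order.min 1 (beta * M w) <= 4 * M w.
      apply: ler_piMr; first by rewrite mulr_ge0.
      by rewrite ge_min lexx.
    by lra.
  by apply: has_meanD; [exact: has_mean_cst | exact: has_meanZ].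
have [e e0 He] := capacity_slack load_capacity.
(* Outside [C], [capacity_slack] puts the value of the best schedule above [thr]. *)
pose C := [set q : nvec n | e * \sum_j (q j)%:R < thr].
have finC : finite_set C.
  apply: sub_finite_set (finite_bounded_vectors n (Num.truncn (thr / e)).+1).
  move=> q Cq j; rewrite -(ler_nat R) ltW//.
  apply: le_lt_trans (truncnS_gt (thr / e)); rewrite ler_pdivlMr// mulrC.
  apply: ltW; apply: le_lt_trans Cq; rewrite ler_pM2l//.
  by rewrite (bigD1 j)//= lerDl sumr_ge0.
have Wdrift q : ~ C q ->
    (transition P (queue_process X pi) (EFin \o W) q + (c / 2)%:E <= (W q)%:E)%E.
  move=> nCq; have [mv [mvP incP]] := increment_mean X pi_policy q.
  pose mu j := arrival_rate N ord0 j
     + \sum_k routing_mx N k j * (completion_prob N k * mv k)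
     - completion_prob N j * mv j.
  (* [Hb] bounds the form at every outcome, for the schedule served there. The form is affine in the
     service, so that minus its mean is the mean drift in direction [Gq q]. *)
  have Gmu : \sum_j Gq q ord0 j * mu j <= - c.
    apply: (has_mean_le (P := P)
      (f := fun w => - bilin (flow_mx N) (Gq q) (excess_service N (served X pi q w)))
      (g := fun=> - c)); last exact: has_mean_cst.
      move=> w; rewrite lerN2.
      have sP := served_schedule X pi_policy q w.
      have pP := pi_policy.1 q (tie X 0 w).
      apply: (Hb (queue_vec R q) [` pP]%fset [` sP]%fset) => /=.
      - move=> i; rewrite !dotv_excess// lerD2r; exact: pi_maxweight (valP i).
      - have [|s sS qs] := He (queue_vec R q); first by move=> j; rewrite mxE.
        apply: (@le_trans _ _ (dotv (queue_vec R q) (excess_service N s))).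
          apply: (@le_trans _ _ (e * \sum_j queue_vec R q ord0 j)).
            under eq_bigr => j _ do rewrite mxE.
            by rewrite leNgt; exact/negP.
          apply: le_trans qs _; rewrite dotvE.
          by apply: ler_sum => j _; rewrite [excess_service _ _ _ _]mxE.
        by rewrite !dotv_excess lerD2r; exact: pi_maxweight.
      - exact: served_gap.
    under [X in has_mean _ X]eq_fun => w do rewrite bilin_flow_excess//.
    apply: has_mean_sum => j; apply: has_meanZ; apply: has_meanD.
      apply: has_meanD; first exact: has_mean_cst.
      by apply: has_mean_sum => k; do 2 apply: has_meanZ.
    rewrite -mulN1r; under [X in has_mean _ X]eq_fun => w do rewrite -mulN1r.
    by do 2 apply: has_meanZ.
  (* The first-order mean is at most [- c] and the remainder [r] at most [c / 2]. *)
  apply: le_trans (leeD2r _ (_ : _ <= (W q + \sum_j Gq q ord0 j * mu j + r)%:E)%E) _.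
    apply: (transition_le_mean pi_policy W0 (f := fun w => W q + \sum_j Gq q ord0 j *
       ((queue_process X pi q 1 w j)%:R - (q j)%:R)
       + 4 * M w * Order.min 1 (beta * M w))).
      move=> w; apply: le_trans (Wle q w) _; rewrite lerD2r lerD2l.
      rewrite -bilin_sumr -/(dotv _ _) dotvE; apply: ler_sum => j _.
      by rewrite [dq _ _ _ _]mxE mulrC.
    apply: has_meanD => //; apply: has_meanD; first exact: has_mean_cst.
    by apply: has_mean_sum => j; apply: has_meanZ; exact: incP.
  by rewrite -EFinD lee_fin; move: Gmu rle; lra.
pose Q := queue_process X pi.
apply: (@foster_positive_recurrent R (nvec n) d T P Q _ _ _ W C (c / 2)
  (5 * (gm * \sum_j (arrival_rate N ord0 j + (n.+1 * B)%N%:R)))) => //.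
- by move=> x w; have [] := full_state0 X pi x w.
- by move=> x t; exact: queue_process_discrete.
- exact: queue_process_markovian.
- by rewrite divr_gt0.
- rewrite !mulr_ge0// sumr_ge0// => j _.
  by rewrite addr_ge0// arrival_rate_ge0.
Qed.
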